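(* Let $(X,\mathcal{A},\mu,T,\xi)$ be an ergodic probability preserving Gibbs-Markov system. Let $(A_l)$ be a sequence of asymptotically rare events such that each $A_l$ is $\xi$-measurable (a union of elements of $\xi$, mod $\mu$). a) Then $(A_l)$ exhibits Poisson asymptotics: $\mu(A_l)\Phi_{A_l}\overset{\mu}{\Longrightarrow}\Phi_{\mathrm{Exp}}$ and $\mu(A_l)\Phi_{A_l}\overset{\mu_{A_l}}{\Longrightarrow}\Phi_{\mathrm{Exp}}$ as $l\to\infty$. b) Assume further that for some integer $m\ge2$ each $A_l$ is partitioned into $\xi$-measurable subsets $A_l^{(1)},\ldots,A_l^{(m)}$ with $\mu_{A_l}(A_l^{(j)})\to\vartheta_j\in(0,1)$ as $l\to\infty$. Define local observables $\psi_{A_l}(x):=j$ for $x\in A_l^{(j)}$. Then, as $l\to\infty$, both $(\mu(A_l)\Phi_{A_l},\widetilde\Psi_{A_l})\overset{\mu_{A_l}}{\Longrightarrow}(\Phi_{\mathrm{Exp}},\Psi^\ast)$ and $(\mu(A_l)\Phi_{A_l},\Psi_{A_l})\overset{\mu}{\Longrightarrow}(\Phi_{\mathrm{Exp}},\Psi^\ast)$, where $(\Phi_{\mathrm{Exp}},\Psi^\ast)$ is an independent pair with $\Psi^\ast$ a $(\vartheta_1,\ldots,\vartheta_m)$-Bernoulli sequence.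
   Context: A probability preserving Gibbs-Markov system $(X,\mathcal{A},\mu,T,\xi)$: $(X,d_X)$ is a metric space with $\mathrm{diam}(X)<\infty$, $\mathcal{A}$ its Borel $\sigma$-algebra, $\mu$ a $T$-invariant probability, $\xi$ a countable partition (mod $\mu$) of $X$ into open sets such that each restriction $T|_Z$, $Z\in\xi$, is a homeomorphism onto $TZ$ which is null-preserving; the system is Markov ($TZ\cap Z'\ne\varnothing$ for $Z,Z'\in\xi$ implies $Z'\subseteq TZ$); with $\xi_n$ the cylinders $\bigcap_{i=0}^{n-1}T^{-i}Z_i$, $Z_i\in\xi$, some iterate $T^N$ is uniformly expanding ($d_X(x,y)\le\rho\,d_X(T^Nx,T^Ny)$ for $x,y$ in a common element of $\xi_N$, some $\rho\in(0,1)$); big image property $\inf_{Z\in\xi}\mu(TZ)>0$; and the inverse branches $v_Z=(T|_Z)^{-1}$ have Radon–Nikodym derivatives $v_Z'=d(\mu\circ v_Z)/d\mu$ with versions satisfying $|v_Z'(x)/v_Z'(y)-1|\le r\,d_X(x,y)$ for $x,y\in TZ$, $Z\in\xi$, for some $r>0$. For $A$ with $\mu(A)>0$: $\varphi_A(x):=\inf\{n\ge1:T^nx\in A\}$, $T_Ax:=T^{\varphi_A(x)}x$, $\mu_A:=\mu(A\cap\cdot)/\mu(A)$, $\Phi_A:=(\varphi_A,\varphi_A\circ T_A,\ldots)$. Asymptotically rare: $0<\mu(A_l)\to0$. For $\psi_A:A\to\{1,\ldots,m\}$: $\Psi_A:=(\psi_A\circ T_A,\psi_A\circ T_A^2,\ldots)$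 on $X$, $\widetilde\Psi_A:=(\psi_A,\psi_A\circ T_A,\ldots)$ on $A$. $\Phi_{\mathrm{Exp}}$: iid standard exponential sequence. $\overset{\nu}{\Longrightarrow}$: weak convergence of laws under $\nu$. *)

(* Defs.v *)
From HB Require Import structures.
From mathcomp Require Import all_boot all_order all_algebra.
From mathcomp Require Import all_classical all_reals all_analysis.
Set Implicit Arguments. Unset Strict Implicit. Unset Printing Implicit Defensive.
Import Order.TTheory GRing.Theory Num.Theory.
Import numFieldNormedType.Exports.
Local Open Scope classical_set_scope.
Local Open Scope ring_scope.

Section Defs.
Context {R : realType}.

Definition is_metric {X : Type} (dX : X -> X -> R) :=
  [/\ forall x y, 0 <= dX x y, forall x y, dX x y = 0 <-> x = y,
      forall x y, dX x y = dX y x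
    & forall x y z, dX x z <= dX x y + dX y z].

Definition finite_diam {X : Type} (dX : X -> X -> R) :=
  exists D : R, forall x y, dX x y <= D.

Definition dopen {X : Type} (dX : X -> X -> R) (U : set X) :=
  forall x, U x -> exists2 e : R, 0 < e & forall y, dX x y < e -> U y.

Definition borel_of {d} {X : measurableType d} (dX : X -> X -> R) :=
  [set A : set X | measurable A] = <<s [set U | dopen dX U] >>.

Definition hits {X : Type} (T : X -> X) (A : set X) (x : X) (n : nat) :=
  (1 <= n)%N /\ A (iter n T x).

(* phi_A x = inf {n >= 1 : T^n x \in A}; convention: 0 if x never enters A
   (a mu-null set when mu is ergodic and mu A > 0) *)
Definition retime {X : Type} (T : X -> X) (A : set X) (x : X) : nat :=
  xget 0%N [set n | hits T A x n /\ forall k, hits T A x k -> (n <= k)%N].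

Definition induced {X : Type} (T : X -> X) (A : set X) (x : X) : X :=
  iter (retime T A x) T x.

Definition scaled_Phi {X : Type} (T : X -> X) (A : set X) (c : R) (x : X)
  : nat -> R :=
  fun k => c * (retime T A (iter k (induced T A) x))%:R.

Definition Psi_seq {X : Type} (T : X -> X) (A : set X) (psi : X -> nat) (x : X)
  : nat -> R := fun k => (psi (iter k.+1 (induced T A) x))%:R.

Definition Psi_tilde {X : Type} (T : X -> X) (A : set X) (psi : X -> nat) (x : X)
  : nat -> R := fun k => (psi (iter k (induced T A) x))%:R.

Definition loc_obs {X : Type} (m : nat) (Apart : nat -> set X) (x : X) : nat :=
  xget 0%N [set j | (1 <= j <= m)%N /\ Apart j x].

Definition partition_mod {d} {X : measurableType d}
   (mu : {measure set X -> \bar R}) (xi : set (set X)) :=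
  [/\ countable xi,
      forall Z Z', xi Z -> xi Z' -> Z <> Z' -> Z `&` Z' = set0
    & mu (~` \bigcup_(Z in xi) Z) = 0%E].

Definition xi_measurable {d} {X : measurableType d}
   (mu : {measure set X -> \bar R}) (xi : set (set X)) (A : set X) :=
  exists2 S : set (set X), S `<=` xi &
     mu ((A `\` \bigcup_(Z in S) Z) `|` ((\bigcup_(Z in S) Z) `\` A)) = 0%E.

Definition GibbsMarkov {d} {X : measurableType d} (dX : X -> X -> R)
  (mu : probability X R) (T : X -> X) (xi : set (set X)) :=
  [/\ is_metric dX /\ finite_diam dX /\ borel_of dX,
      measurable_fun setT T /\
      (forall A, measurable A -> mu (T @^-1` A) = mu A),
      (partition_mod mu xi /\ (forall Z, xi Z -> dopen dX Z)) /\
      (forall Z, xi Z -> [/\ measurable (T @` Z),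
          {in Z &, injective T},
          (forall x, Z x -> forall e, 0 < e -> exists2 del, 0 < del &
             forall y, Z y -> dX x y < del -> dX (T x) (T y) < e)
        & (forall x, Z x -> forall e, 0 < e -> exists2 del, 0 < del &
             forall y, Z y -> dX (T x) (T y) < del -> dX x y < e)]) /\
      (forall Z, xi Z -> forall B, measurable B ->
          (mu (B `&` T @` Z) = 0%E <-> mu (Z `&` T @^-1` B) = 0%E)),
      (forall Z Z', xi Z -> xi Z' -> T @` Z `&` Z' !=set0 -> Z' `<=` T @` Z) &
      [/\
        (exists N : nat, exists rho : R, [/\ (1 <= N)%N, 0 < rho, rho < 1 &
          forall x y, (forall i, (i < N)%N -> exists2 Z, xi Z &
                          Z (iter i T x) /\ Z (iter i T y)) ->
            dX x y <= rho * dX (iter N T x) (iter N T y)]),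
        (exists2 c : R, 0 < c & forall Z, xi Z -> (c%:E <= mu (T @` Z))%E) &
        (* versions of the Radon-Nikodym derivatives v_Z' of mu o v_Z
           with the Lipschitz ratio (distortion) bound *)
        (exists v : set X -> X -> R, exists2 r : R, 0 < r &
          forall Z, xi Z -> [/\ measurable_fun (T @` Z) (v Z),
             (forall x, (T @` Z) x -> 0 < v Z x),
             (forall B, measurable B ->
                (mu (Z `&` T @^-1` B) = \int[mu]_(x in B `&` T @` Z) (v Z x)%:E)%E)
           & (forall x y, (T @` Z) x -> (T @` Z) y ->
                `|v Z x / v Z y - 1| <= r * dX x y)])]].

Definition ergodic {d} {X : measurableType d} (mu : probability X R)
  (T : X -> X) :=
  forall A, measurable A -> T @^-1` A = A -> mu A = 0%E \/ mu A = 1%E.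

Definition mutually_independent {dO} {O : measurableType dO}
  (P : probability O R) {I : eqType} (Y : I -> O -> R) :=
  (forall i, measurable_fun setT (Y i)) /\
  forall (J : seq I) (B : I -> set R), uniq J ->
    (forall i, measurable (B i)) ->
    P (\bigcap_(i in [set i | i \in J]) (Y i @^-1` B i))
      = (\prod_(i <- J) P (Y i @^-1` B i))%E.

Definition std_exponential {dO} {O : measurableType dO}
  (P : probability O R) (Y : O -> R) :=
  forall t : R, P (Y @^-1` `]-oo, t]) =
    (if t < 0 then 0%E else (1 - expR (- t))%:E).

Definition bdd_cont {S : topologicalType} (g : S -> R) :=
  continuous g /\ exists M : R, forall s, `|g s| <= M.

(* law of Y_l under mu_{A_l} (conditional measure mu(A_l `&` .)/mu(A_l))
   converges weakly to the law of Z under P *)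
Definition wconv {d} {X : measurableType d} {dO} {O : measurableType dO}
  {S : topologicalType} (mu : probability X R) (A : nat -> set X)
  (Y : nat -> X -> S) (P : probability O R) (Z : O -> S) :=
  forall g : S -> R, bdd_cont g ->
    (fun l => fine (\int[mu]_(x in A l) (g (Y l x))%:E)%E / fine (mu (A l)))
      @ \oo --> fine (\int[P]_w (g (Z w))%:E)%E.

End Defs.

(* Main.v *)
Require Import Defs.
From HB Require Import structures.
From mathcomp Require Import all_boot all_order all_algebra.
From mathcomp Require Import all_classical all_reals all_analysis.
From mathcomp Require Import measurable_realfun.
From mathcomp Require Import ring lra zify.
Import Order.TTheory GRing.Theory Num.Theory.
Import numFieldNormedType.Exports.
Local Open Scope classical_set_scope.
Local Open Scope ring_scope.

(** Write [E n W] for the event that the first entrance to [A] occurs after time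
    [n] and in the subset [W]; it is almost [T]-invariant when [A] is rare.
    Ergodicity makes almost invariant sets asymptotically independent of every
    fixed event: any ultrafilter limit of their traces is a charge dominated by
    [mu] and [T]-invariant, hence proportional to [mu].  Bounded distortion makes
    the image under [T] of the conditional measure on a union [D] of cells nearly
    proportional to [mu] on each small cylinder, which upgrades this to
    [mu (D & E n W) = mu D * (mu (E n W) + o(1))], uniformly in [n].

    Invariance of [mu] gives the exact identities
    [mu (E n W) - mu (E n.+1 W) = mu (A & E n W)] and [mu (A & E 0 W) = mu W], so
    with [D = A] the sequence [n |-> mu (E n W)] is nearly geometric of ratio
    [1 - mu A] and initial value [mu W / mu A].  Iterating with
    [W = D_1 & E n_1 (D_2 & ...)] gives the probabilities of all boxes, for both
    initial measures; weak convergence on the sequence space follows because a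
    nonnegative continuous function is a limit from below of functions that are
    constant on the cells of a finite mesh. *)

(** * Finite-valued probabilities and invariant charges *)

(** An ergodic Gibbs-Markov system may be periodic, so no decay of correlations is available, and
    the sets [W] produced by the iteration encode the whole future of an orbit and are not unions of
    cells. The events [E n W] are therefore never approximated by simpler ones: only their near
    invariance is used, while regularity enters solely through the set [D] on which the orbit
    starts, and through a single application of [T].

    An ultrafilter is used rather than a subsequence because limits are wanted for all measurable
    sets at once; domination by [mu] turns the resulting finitely additive limit into a countably
    additive one, to which the Hahn decomposition applies.

    In the last stage only lower bounds on box probabilities are proved. They determine the limit
    because all the measures involved have total mass 1: applied to [M + g] and to [M - g], they
    bound the integral of [g] from both sides. *)

Definition pr {R : realType} {d} {X : measurableType d} (mu : probability X R)
  (B : set X) : R := fine (mu B).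

Section RealProbability.
Context {R : realType} {d} {X : measurableType d} (mu : probability X R).
Implicit Types B C : set X.

Lemma prE B : measurable B -> mu B = (pr mu B)%:E.
Proof. by move=> mB; rewrite /pr fineK// fin_num_measure. Qed.

Lemma pr_ge0 B : 0 <= pr mu B.
Proof. by rewrite /pr fine_ge0. Qed.

Lemma pr_set0 : pr mu set0 = 0.
Proof. by rewrite /pr measure0. Qed.

Lemma pr_setT : pr mu setT = 1.
Proof. by rewrite /pr probability_setT. Qed.

Lemma pr_le B C : measurable B -> measurable C -> B `<=` C -> pr mu B <= pr mu C.
Proof.
by move=> mB mC BC; rewrite -lee_fin -!prE// le_measure// inE.
Qed.

Lemma pr_le1 B : measurable B -> pr mu B <= 1.
Proof. by move=> mB; rewrite -pr_setT; apply: pr_le. Qed.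

Lemma prU B C : measurable B -> measurable C -> B `&` C = set0 ->
  pr mu (B `|` C) = pr mu B + pr mu C.
Proof.
move=> mB mC BC; apply: EFin_inj; rewrite EFinD -!prE//; last exact: measurableU.
by rewrite measureU.
Qed.

Lemma pr_split B C : measurable B -> measurable C ->
  pr mu B = pr mu (B `&` C) + pr mu (B `\` C).
Proof.
move=> mB mC; rewrite -prU; last 1 first.
- by apply/seteqP; split => // x [[? ?] [_]].
- by rewrite setUIDK.
- exact: measurableI.
- exact: measurableD.
Qed.

Lemma pr_setC B : measurable B -> pr mu (~` B) = 1 - pr mu B.
Proof. by move=> mB; have := pr_split _ _ measurableT mB; rewrite pr_setT setTI setTD => ->; lra. Qed.

Lemma pr_setU_le B C : measurable B -> measurable C ->
  pr mu (B `|` C) <= pr mu B + pr mu C.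
Proof.
move=> mB mC; have -> : B `|` C = B `|` (C `\` B).
  by apply/seteqP; split => x /=; have [] := pselect (B x); tauto.
rewrite prU //; last 1 first.
- by apply/seteqP; split => // x [? []].
- by rewrite lerD2l; apply: pr_le => //; exact: measurableD.
- by apply: measurableD.
Qed.

Lemma pr_bigcup_cvg (F : nat -> set X) : (forall n, measurable (F n)) ->
  trivIset setT F ->
  (fun n => \sum_(0 <= i < n) pr mu (F i)) @ \oo --> pr mu (\bigcup_n F n).
Proof.
move=> mF tF; have mUF : measurable (\bigcup_n F n) by exact: bigcup_measurable.
have : (fun n => \sum_(0 <= i < n) mu (F i))%E @ \oo --> mu (\bigcup_n F n).
  exact: measure_semi_sigma_additive.
rewrite (prE _ mUF).
rewrite (_ : (fun n => _) = (fun n => (\sum_(0 <= i < n) pr mu (F i))%:E)).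
  by move/fine_cvgP => [].
by apply/funext => n; rewrite -sumEFin; apply: eq_bigr => i _; rewrite prE.
Qed.

Lemma pr_bigsetU (I : choiceType) (r : seq I) (C : I -> set X) B :
  measurable B -> (forall i, measurable (C i)) ->
  (forall i j, i <> j -> C i `&` C j = set0) -> uniq r ->
  pr mu B = \sum_(i <- r) pr mu (B `&` C i) + pr mu (B `\` \big[setU/set0]_(i <- r) C i).
Proof.
move=> mB mC dC; elim: r => [|i r IH] /=; first by rewrite !big_nil add0r setD0.
move=> /andP[ir ur]; rewrite !big_cons {1}(IH ur).
have mU : measurable (\big[setU/set0]_(j <- r) C j) by exact: bigsetU_measurable.
rewrite (pr_split (B `\` _) (C i))//; last exact: measurableD.
rewrite (_ : (B `\` _) `&` C i = B `&` C i); last first.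
  apply/seteqP; split => x /=; first by tauto.
  move=> [Bx Cx]; split=> //; split => //; rewrite -bigcup_seq => -[j /= jr Cj].
  have ij : i <> j by move=> ij; rewrite ij jr in ir.
  by have : (C i `&` C j) x by []; rewrite dC.
rewrite (_ : (B `\` _) `\` C i = B `\` (C i `|` \big[setU/set0]_(j <- r) C j)); last first.
  by apply/seteqP; split => x /=; tauto.
ring.
Qed.

Lemma pr_bigsetU_sum (I : choiceType) (r : seq I) (C : I -> set X) :
  (forall i, measurable (C i)) -> (forall i j, i <> j -> C i `&` C j = set0) -> uniq r ->
  pr mu (\big[setU/set0]_(i <- r) C i) = \sum_(i <- r) pr mu (C i).
Proof.
move=> mC dC ur; have mU : measurable (\big[setU/set0]_(i <- r) C i) by exact: bigsetU_measurable.
have := pr_bigsetU _ r C setT measurableT mC dC ur.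
rewrite setTD pr_setC// pr_setT (eq_bigr (fun i => pr mu (C i))); first by lra.
by move=> i _; rewrite setTI.
Qed.

Lemma pr_bigsetU_le (I : Type) (r : seq I) (C : I -> set X) :
  (forall i, measurable (C i)) ->
  pr mu (\big[setU/set0]_(i <- r) C i) <= \sum_(i <- r) pr mu (C i).
Proof.
move=> mC; elim: r => [|i r IH]; first by rewrite !big_nil pr_set0.
rewrite !big_cons; apply: le_trans (pr_setU_le _ _ (mC i) _) _.
  exact: bigsetU_measurable.
by rewrite lerD2l.
Qed.

End RealProbability.

(** * Ergodicity for invariant charges dominated by [mu] *)

Section InvariantCharge.
Context {R : realType} {d} {X : measurableType d} (mu : probability X R).
Context (T : X -> X) (s : set X -> R).
Context (mT : measurable_fun setT T).
Context (sU : forall B C, measurable B -> measurable C -> B `&` C = set0 ->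
  s (B `|` C) = s B + s C).
Context (s_le : forall B, measurable B -> `|s B| <= pr mu B).
Context (sT : forall B, measurable B -> s (T @^-1` B) = s B).

Let mTpre B : measurable B -> measurable (T @^-1` B).
Proof. by move=> mB; rewrite -[_ @^-1` _]setTI; apply: mT. Qed.

Let s0 : s set0 = 0.
Proof.
by apply/eqP; rewrite -normr_le0 (le_trans (s_le _ measurable0))// pr_set0.
Qed.

Let s_split B C : measurable B -> measurable C -> s B = s (B `&` C) + s (B `\` C).
Proof.
move=> mB mC; rewrite -sU ?setUIDK//; last 2 first.
- exact: measurableD.
- by apply/seteqP; split => // x [[? ?] [_]].
- exact: measurableI.
Qed.

Let nu_fun : set X -> \bar R := fun B => (s B)%:E.

(** Countable additivity is inherited from [mu]: the tail unions [U n] have measure tending to 0,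
    and [s] is dominated by [pr mu] on them. *)
Let nu_sigma : semi_sigma_additive nu_fun.
Proof.
move=> F mF tF mUF; rewrite /nu_fun.
pose U n := \bigcup_(i in [set i | (n <= i)%N]) F i.
have mU n : measurable (U n) by apply: bigcup_measurable => i _; exact: mF.
have UE n : U n = F n `|` U n.+1.
  apply/seteqP; split => x /=.
    move=> [i /= ni Fi]; case: (ltngtP n i) ni => // [ni _|ni _].
      by right; exists i.
    by left; rewrite ni.
  by move=> [Fx|[i /= ni Fi]]; [exists n => /=|exists i => //=; exact: ltnW].
have dU n : F n `&` U n.+1 = set0.
  apply/seteqP; split => // x [Fx [i /= ni Fi]].
  have : n = i by apply: tF => //; exists x.
  by move=> ni'; rewrite ni' ltnn in ni.
have sum_s n : \sum_(0 <= i < n) s (F i) = s (\bigcup_n F n) - s (U n).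
  elim: n => [|n IH].
    rewrite big_geq// (_ : U 0%N = \bigcup_n F n) ?subrr//.
    by rewrite /U; congr bigcup; apply/seteqP; split.
  by rewrite big_nat_recr//= IH {1}(UE n) sU//; ring.
have pU n : pr mu (U n) = pr mu (\bigcup_n F n) - \sum_(0 <= i < n) pr mu (F i).
  elim: n => [|n IH].
    rewrite big_geq// subr0; congr (pr mu _).
    by rewrite /U; congr bigcup; apply/seteqP; split.
  by rewrite big_nat_recr//= opprD addrA -IH {1}(UE n) prU//; ring.
have pU0 : pr mu (U n) @[n --> \oo] --> (0 : R).
  have h : (fun n => pr mu (\bigcup_n F n) - \sum_(0 <= i < n) pr mu (F i)) @ \oo
      --> pr mu (\bigcup_n F n) - pr mu (\bigcup_n F n).
    apply: cvgB; first exact: cvg_cst. exact: pr_bigcup_cvg.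
  by rewrite subrr in h; rewrite (funext pU).
rewrite (_ : (fun n => _) = (fun n => (s (\bigcup_n F n) - s (U n))%:E)); last first.
  by apply/funext => n; rewrite sumEFin sum_s.
apply/fine_cvgP; split; first exact: nearW.
have h : s (U n) @[n --> \oo] --> (0 : R).
  apply/cvgr0Pnorm_lt => e e0.
  move/cvgr0Pnorm_lt : pU0 => /(_ _ e0); apply: filterS => n.
  by rewrite ger0_norm ?pr_ge0// => /(le_lt_trans _); apply; exact: s_le.
have := @cvgB _ _ _ _ _ _ _ _ _ (@cvg_cst _ (s (\bigcup_n F n)) _ \oo _) h.
by rewrite subr0; apply.
Qed.

(** The positive set [D] of a Hahn decomposition is invariant up to null sets, because the charge
    is. Ergodicity makes it trivial for [mu], and domination together with total mass 0 leaves no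
    charge on either side. *)
Lemma invariant_charge_eq0 : ergodic mu T -> s setT = 0 ->
  forall B, measurable B -> s B = 0.
Proof.
move=> ergT sT0.
have nu_fin B : measurable B -> nu_fun B \is a fin_num by [].
have nu0 : nu_fun set0 = 0%E by rewrite /nu_fun s0.
pose nu : {charge set X -> \bar R} :=
  HB.pack nu_fun (isCharge.Build _ X R nu_fun nu0 nu_fin nu_sigma).
have [D [N [[mD pos] [mN neg] DN DN0]]] := Hahn_decomposition nu.
have posD B : measurable B -> B `<=` D -> 0 <= s B.
  by move=> mB BD; rewrite -lee_fin; exact: pos.
have negD B : measurable B -> B `<=` ~` D -> s B <= 0.
  move=> mB BD; rewrite -lee_fin; apply: neg => // x Bx.
  by have : (D `|` N) x by [rewrite DN]; case=> // /(BD _ Bx).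
(* Null for the variation of [s]. By [nulP] it suffices to test the two halves cut by the Hahn set,
   since [s] has constant sign on each. *)
pose nul E := measurable E /\ forall B, measurable B -> B `<=` E -> s B = 0.
have nulP E : measurable E -> s (E `&` D) = 0 -> s (E `\` D) = 0 -> nul E.
  move=> mE e1 e2; split=> // B mB BE.
  have mBD := measurableI _ _ mB mD; have mBD' := measurableD mB mD.
  rewrite (s_split B D)//.
  have := s_split (E `&` D) B (measurableI _ _ mE mD) mB.
  have := s_split (E `\` D) B (measurableD mE mD) mB.
  rewrite e1 e2 (_ : E `&` D `&` B = B `&` D) 1?(_ : (E `\` D) `&` B = B `\` D).
  - have := posD _ mBD (@subIsetr _ _ _).
    have := negD _ mBD' (@subIsetr _ _ _).
    have := posD (E `&` D `\` B) (measurableD (measurableI _ _ mE mD) mB) _.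
    have := negD (E `\` D `\` B) (measurableD (measurableD mE mD) mB) _.
    by move=> /(_ ltac:(by move=> x [[]])) + /(_ ltac:(by move=> x [[]])); lra.
  - by apply/seteqP; split => x /=; have := BE x; tauto.
  - by apply/seteqP; split => x /=; have := BE x; tauto.
have mTD := mTpre _ mD.
(* The two charges are equal because [T^-1 D] and [D] have the same charge; one is nonpositive and
   the other nonnegative. *)
have [sTD_D sD_TD] : s (T @^-1` D `\` D) = 0 /\ s (D `\` T @^-1` D) = 0.
  have := s_split (T @^-1` D) D mTD mD; have := s_split D (T @^-1` D) mD mTD.
  rewrite sT// setIC.
  have := posD _ (measurableD mD mTD) (@subDsetl _ _ _).
  have := negD _ (measurableD mTD mD) (@subIsetr _ _ _).
  by split; lra.
have nTD_D : nul (T @^-1` D `\` D).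
  apply: nulP; first exact: measurableD.
  - rewrite (_ : _ `&` _ = set0)//; apply/seteqP; split => // x /=; tauto.
  - by rewrite (_ : _ `\` _ = T @^-1` D `\` D)//; apply/seteqP; split => // x /=; tauto.
have nD_TD : nul (D `\` T @^-1` D).
  apply: nulP; first exact: measurableD.
  - by rewrite (_ : _ `&` _ = D `\` T @^-1` D)//; apply/seteqP; split => // x /=; tauto.
  - rewrite (_ : _ `\` _ = set0)//; apply/seteqP; split => // x /=; tauto.
(* Exchanging [D] for [T^-1 D] does not change charges, so the part of [T^-1 E] in [D] has the
   charge of [T^-1 (E & D)], that is, of [E & D]. *)
have nulT E : nul E -> nul (T @^-1` E).
  move=> [mE nE]; have mTE := mTpre _ mE.
  have e0 : s (T @^-1` E `&` D) = 0.
    rewrite (s_split _ (T @^-1` D)) ?(nD_TD.2 (T @^-1` E `&` D `\` T @^-1` D)) ?addr0//.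
    + have := s_split (T @^-1` (E `&` D)) D (mTpre _ (measurableI _ _ mE mD)) mD.
      rewrite sT; last exact: measurableI.
      rewrite nE//; last exact: measurableI.
      rewrite (nTD_D.2 (_ `\` D)).
      * by rewrite addr0 preimage_setI setIAC.
      * by apply: measurableD => //; apply: mTpre; exact: measurableI.
      * by move=> x /=; tauto.
    + by apply: measurableD => //; exact: measurableI.
    + by move=> x /=; tauto.
    + exact: measurableI.
  apply: nulP => //.
  by have := s_split _ D mTE mD; rewrite e0 add0r sT// nE.
have miter k E : measurable E -> measurable (iter k T @^-1` E).
  by elim: k E => //= k IH E mE; rewrite [X in measurable X](_ : _ = iter k T @^-1` (T @^-1` E))//; apply: IH; exact: mTpre.
have nuliter k E : nul E -> nul (iter k T @^-1` E).
  by elim: k E => //= k IH E nE; rewrite [X in nul X](_ : _ = iter k T @^-1` (T @^-1` E))//; apply: IH; exact: nulT.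
(* A null set is one that is negative both for [nu] and for its opposite, and negative sets are
   stable under countable unions. *)
have nulU (F : nat -> set X) : (forall i, nul (F i)) -> nul (\bigcup_i F i).
  move=> nF; split; first by apply: bigcup_measurable => i _; have [] := nF i.
  move=> B mB BF; apply/eqP; rewrite eq_le; apply/andP; split.
    have [_ h] : negative_set nu (\bigcup_i F i).
      apply: bigcup_negative_set => i; have [mFi sFi] := nF i; split=> // E mE EF.
      by change ((s E)%:E <= 0)%E; rewrite sFi.
    by rewrite -lee_fin; exact: h.
  have [_ h] : negative_set (copp nu) (\bigcup_i F i).
    apply: bigcup_negative_set => i; have [mFi sFi] := nF i; split=> // E mE EF.
    by change (- (s E)%:E <= 0)%E; rewrite sFi// oppe0.
  by rewrite -oppr_le0 -lee_fin; exact: h.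
(* the strictly invariant version of [D] required by [ergodic] *)
pose Dinf := \bigcap_n \bigcup_(k in [set k | (n <= k)%N]) iter k T @^-1` D.
have mDinf : measurable Dinf.
  by apply: bigcap_measurable => // n _; apply: bigcup_measurable => k _; exact: miter.
have Dinf_inv : T @^-1` Dinf = Dinf.
  apply/seteqP; split => x Dx n _.
    have [k /= nk] := Dx n I; rewrite -iterSr => Dk.
    by exists k.+1 => //=; exact: leqW.
  have [[//|k] /= nk] := Dx n.+1 I; rewrite -iterS iterSr => Dk.
  by exists k.
have [_ n1] : nul (\bigcup_k iter k T @^-1` (T @^-1` D `\` D)).
  by apply: nulU => k; exact: nuliter.
have [_ n2] : nul (\bigcup_k iter k T @^-1` (D `\` T @^-1` D)).
  by apply: nulU => k; exact: nuliter.
(* An orbit that starts outside [D] and visits it must at some time pass from outside [D] to [D],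
   hence meet [T^-1 D \ D]. For [s2], an orbit that starts in [D] and visits it only finitely often
   must leave it at some time. *)
have s1 : s (Dinf `\` D) = 0.
  apply: n1; first exact: measurableD.
  move=> x [Dx nDx]; have [k0 _ Dk0] := Dx 0%N I.
  apply: contrapT => nk.
  suff : forall k, ~ D (iter k T x) by move/(_ k0).
  elim=> //= k IH Dk; apply: nk; exists k => //.
have s2 : s (D `\` Dinf) = 0.
  apply: n2; first exact: measurableD.
  move=> x [Dx nDx]; apply: contrapT => nk; apply: nDx => n _.
  suff h : forall k, D (iter k T x) by exists n => /=.
  elim=> //= k IH; apply: contrapT => nDk; apply: nk; exists k => //.
have sD0 : s D = 0.
  have eD := s_split D Dinf mD mDinf; rewrite s2 addr0 in eD.
  have mDD := measurableI _ _ mD mDinf.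
  (* If [Dinf] is null, domination kills the charge of [D]; if it has full measure, the complement
     of [D] has charge 0 and total mass 0 settles [D]. *)
  have [m0|m1] := ergT _ mDinf Dinf_inv.
    rewrite eD; apply/eqP; rewrite -normr_le0 (le_trans (s_le _ mDD))//.
    by rewrite (le_trans (pr_le mu _ _ mDD mDinf (@subIsetr _ _ _)))// /pr m0.
  have := s_split _ D measurableT mD; rewrite sT0 setTI setTD.
  rewrite (s_split (~` D) Dinf (measurableC mD) mDinf).
  rewrite (_ : ~` D `&` Dinf = Dinf `\` D) ?s1 ?add0r; last by rewrite setIC.
  have mDC := measurableD (measurableC mD) mDinf.
  suff -> : s (~` D `\` Dinf) = 0 by rewrite addr0 => <-.
  apply/eqP; rewrite -normr_le0 (le_trans (s_le _ mDC))//.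
  rewrite (le_trans (pr_le mu _ _ mDC (measurableC mDinf) (@subIsetr _ _ _)))//.
  by rewrite pr_setC// /pr m1 subrr.
have [_ nT] : nul setT.
  apply: nulP => //; first by rewrite setTI.
  by have := s_split _ D measurableT mD; rewrite sT0 setTI sD0 add0r.
by move=> B mB; exact: nT.
Qed.

End InvariantCharge.

(** Compactness of the segment gives a cluster point, and an ultrafilter converges to each of its
    cluster points. *)
Lemma ultra_bounded_cvg {R : realType} {I : Type} (G : set_system I) (f : I -> R) (M : R) :
  UltraFilter G -> (forall i, `|f i| <= M) -> exists p : R, f @ G --> p.
Proof.
move=> UG fM.
have GM : (f @ G) [set` `[- M, M]].
  apply: (@filterS _ G _ setT); last exact: filterT.
  by move=> i _ /=; rewrite in_itv/= -ler_norml.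
have [p [_ clp]] := @segment_compact R (- M) M (f @ G) _ GM.
exists p => V Vp.
have [//|nV] := in_ultra_setVsetC (f @^-1` V) UG.
by have [x []] := clp (~` V) V nV Vp.
Qed.

(** * Almost invariant sets and fixed events *)

Section AsymptoticInvariance.
Context {R : realType} {d} {X : measurableType d} (mu : probability X R).
Context (T : X -> X) (mT : measurable_fun setT T).
Context (muT : forall B, measurable B -> mu (T @^-1` B) = mu B).

Lemma measurable_preimageT B : measurable B -> measurable (T @^-1` B).
Proof. by move=> mB; rewrite -[_ @^-1` _]setTI; apply: mT. Qed.

Lemma measurable_iter k B : measurable B -> measurable (iter k T @^-1` B).
Proof.
elim: k B => //= k IH B mB.
rewrite [X in measurable X](_ : _ = iter k T @^-1` (T @^-1` B))//.
exact/IH/measurable_preimageT.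
Qed.

Lemma pr_preimageT B : measurable B -> pr mu (T @^-1` B) = pr mu B.
Proof. by move=> mB; rewrite /pr muT. Qed.

Lemma pr_iter k B : measurable B -> pr mu (iter k T @^-1` B) = pr mu B.
Proof.
elim: k B => //= k IH B mB.
rewrite [X in pr _ X](_ : _ = iter k T @^-1` (T @^-1` B))//.
by rewrite IH ?pr_preimageT//; exact: measurable_preimageT.
Qed.

(* Along an ultrafilter, [B |-> pr (B `&` H l) - pr B * pr (H l)] converges to
   a [T]-invariant charge of total mass 0, which ergodicity forces to vanish. *)
Lemma invariant_sets_mixing (H : nat -> set X) : ergodic mu T ->
  (forall l, measurable (H l)) ->
  (fun l => pr mu (T @^-1` H l `\` H l)) @ \oo --> (0 : R) ->
  forall B, measurable B ->
  (fun l => pr mu (B `&` H l) - pr mu B * pr mu (H l)) @ \oo --> (0 : R).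
Proof.
move=> ergT mH H0 B0 mB0.
pose a B l := pr mu (B `&` H l) - pr mu B * pr mu (H l).
have a_le B l : measurable B -> `|a B l| <= pr mu B.
  move=> mB; have := pr_le mu _ _ (measurableI _ _ mB (mH l)) mB (@subIsetl _ _ _).
  have := pr_ge0 mu (B `&` H l); have := pr_ge0 mu B.
  have := pr_ge0 mu (H l); have := pr_le1 mu _ (mH l).
  rewrite /a ler_norml => h1 h2 h3 h4 h5; apply/andP; split; nra.
change (a B0 @ \oo --> (0 : R)).
apply: contrapT => /cvgr0Pnorm_lt/existsNP[e /not_implyP[e0 ne]].
(* If the convergence fails, [S] meets every neighbourhood of infinity. An ultrafilter that refines
   [\oo] and contains [S] keeps [a B0] away from 0. *)
pose S := [set l | e <= `|a B0 l|].
have PF : ProperFilter (within S \oo).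
  apply: Build_ProperFilter_ex => // Q [N _ NQ].
  apply: contrapT => nQ; apply: ne; exists N => // l /= Nl.
  rewrite ltNge; apply/negP => Sl; apply: nQ; exists l.
  exact: NQ.
have [G [UG SG]] := ultraFilterLemma PF.
have GS : G S by apply: SG; exact: withinT.
have Goo : \oo `<=` G by move=> Q Qoo; apply: SG; apply: filterS Qoo.
have cvgG f : f @ \oo --> (0 : R) -> f @ G --> (0 : R).
  by move=> f0 V V0; apply: Goo; exact: f0.
(* Measurability is assumed inside the existential so that [choice] returns one function [s] defined
   on all sets. *)
have ex_lim B : exists p : R, measurable B -> a B @ G --> p.
  have [mB|nB] := pselect (measurable B); last by exists 0.
  have [|p ap] := @ultra_bounded_cvg R nat G (a B) 1 UG; last by exists p.
  by move=> l; apply: le_trans (a_le _ l mB) (pr_le1 _ _ mB).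
have [s sP] := choice ex_lim.
have uniq (f : nat -> R) (p q : R) : f @ G --> p -> f @ G --> q -> p = q.
  by move=> fp fq; rewrite -(cvg_lim (@Rhausdorff R) fp) -(cvg_lim (@Rhausdorff R) fq).
have s0 : s B0 = 0.
  apply: (invariant_charge_eq0 mu T s) => //.
  - move=> B C mB mC BC0; apply: (uniq (a (B `|` C))).
      by apply: sP; exact: measurableU.
    rewrite (_ : a (B `|` C) = a B \+ a C); first by apply: cvgD; exact: sP.
    apply/funext => l /=; rewrite /a setIUl !prU//; first by ring.
    + exact: measurableI.
    + exact: measurableI.
    + by rewrite setIACA BC0 set0I.
  - move=> B mB; rewrite ler_norml; have h := sP _ mB.
    apply/andP; split.
      apply: (cvgr_to_ge h); apply: nearW => l.
      by have := a_le _ l mB; rewrite ler_norml => /andP[].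
    apply: (cvgr_to_le h); apply: nearW => l.
    by have := a_le _ l mB; rewrite ler_norml => /andP[].
  - move=> B mB; apply: (uniq (a B)); last exact: sP.
    have mTB := measurable_preimageT _ mB.
    have h := sP _ mTB.
    suff h' : (fun l => a B l - a (T @^-1` B) l) @ G --> (0 : R).
      rewrite -[s (T @^-1` B)]add0r.
      rewrite (_ : a B = (fun l => a B l - a (T @^-1` B) l) \+ a (T @^-1` B)).
        exact: cvgD.
      by apply/funext => l /=; rewrite subrK.
    (* By invariance [B & H] has the measure of [T^-1 B & T^-1 H]. Comparing this set with
       [T^-1 B & H] leaves one part in [T^-1 H \ H] and one in [H \ T^-1 H], two sets of equal
       measure. *)
    apply: cvgG; apply/cvgr0Pnorm_lt => eps eps0.
    move/cvgr0Pnorm_lt : H0 => /(_ _ eps0); apply: filterS => l.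
    rewrite ger0_norm ?pr_ge0//; apply: le_lt_trans.
    have mTH := measurable_preimageT _ (mH l).
    rewrite /a pr_preimageT// -(pr_preimageT (B `&` H l)); last exact: measurableI.
    have e1 := pr_split mu _ _ mTH (mH l).
    have e2 := pr_split mu _ _ (mH l) mTH.
    rewrite pr_preimageT// in e1; rewrite setIC in e2.
    have f1 := pr_split mu (T @^-1` B `&` T @^-1` H l) (H l) (measurableI _ _ mTB mTH) (mH l).
    have f2 := pr_split mu (T @^-1` B `&` H l) (T @^-1` H l) (measurableI _ _ mTB (mH l)) mTH.
    rewrite setIAC in f2.
    have g1 : pr mu ((T @^-1` B `&` T @^-1` H l) `\` H l) <= pr mu (T @^-1` H l `\` H l).
      apply: pr_le; [apply: measurableD => //; exact: measurableI|exact: measurableD|].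
      by move=> x /=; tauto.
    have g2 : pr mu ((T @^-1` B `&` H l) `\` T @^-1` H l) <= pr mu (H l `\` T @^-1` H l).
      apply: pr_le; [apply: measurableD => //; exact: measurableI|exact: measurableD|].
      by move=> x /=; tauto.
    have := pr_ge0 mu ((T @^-1` B `&` T @^-1` H l) `\` H l).
    have := pr_ge0 mu ((T @^-1` B `&` H l) `\` T @^-1` H l).
    rewrite preimage_setI ler_norml => p1 p2; apply/andP; split; lra.
  - apply: (uniq (a setT)); first exact: sP.
    rewrite (_ : a setT = fun=> 0); first exact: cvg_cst.
    by apply/funext => l; rewrite /a setTI pr_setT mul1r subrr.
have := sP _ mB0; rewrite s0 => /cvgr0Pnorm_lt /(_ _ e0).
move=> /(filterI GS)/filter_ex[l [/=]]; rewrite /S/= => h1 h2.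
by have := le_lt_trans h1 h2; rewrite ltxx.
Qed.

End AsymptoticInvariance.

(** * Bounded distortion and Markov cells *)

Section Distortion.
Context {R : realType} {d} {X : measurableType d} (dX : X -> X -> R).
Context (mu : probability X R) (T : X -> X) (xi : set (set X)).
Context (GM : GibbsMarkov dX mu T xi).

Lemma GM_measurable : measurable_fun setT T.
Proof. by case: GM => _ []. Qed.

Lemma GM_invariant B : measurable B -> mu (T @^-1` B) = mu B.
Proof. by case: GM => _ [_ h] _ _ _; exact: h. Qed.

Lemma GM_cell_measurable Z : xi Z -> measurable Z.
Proof.
case: GM => -[_ [_ bX]] _ [[_ oxi] _] _ _ /oxi oZ.
by rewrite -[measurable Z]/([set A | measurable A] Z) bX; exact: sub_sigma_algebra.
Qed.

Let mTpre := measurable_preimageT T GM_measurable.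

(** The first bound holds because the density [v Z] is at most a constant times [mu Z]. For the
    second, the density on [C] is compared with its value at one point of [C]. Ratios are multiplied
    out so that null sets [C] are allowed. *)
Lemma GM_distortion : exists K r : R, [/\ 0 < K, 0 < r & forall Z, xi Z ->
  (forall B, measurable B -> pr mu (Z `&` T @^-1` B) <= K * pr mu Z * pr mu B) /\
  (forall C e, measurable C -> 0 <= e -> C `<=` T @` Z ->
     (forall x y, C x -> C y -> dX x y <= e) ->
     forall B, measurable B -> B `<=` C ->
     `|pr mu (Z `&` T @^-1` B) * pr mu C - pr mu (Z `&` T @^-1` C) * pr mu B|
       <= r * e * pr mu Z * pr mu B * pr mu C)].
Proof.
have mxi := GM_cell_measurable.
case: GM => -[metX [[D DX] _]] _ [_ [imxi _]] _ [_ [c c0 cxi] [v [r r0 vxi]]].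
have [x0 _] : exists x0 : X, True.
  apply: contrapT => nX; have := pr_setT mu; rewrite (_ : setT = set0) ?pr_set0.
    by move=> /eqP; rewrite eq_sym oner_eq0.
  by apply/seteqP; split => // x; case: nX; exists x.
have D0 : 0 <= D by case: metX => h _ _ _; exact: le_trans (h x0 x0) (DX x0 x0).
(* Two values of the density differ at most by the factor [1 + r * D], and it integrates to [mu Z]
   over an image of measure at least [c]; hence the bound [K1 * mu Z]. *)
pose K1 := (1 + r * D) / c.
pose K := (1 + r * D) * K1.
have rD0 : 0 <= r * D by rewrite mulr_ge0// ltW.
have K10 : 0 < K1 by rewrite divr_gt0//; lra.
have K0 : 0 < K by rewrite mulr_gt0//; lra.
have K20 : 0 < 2 * r * K1 by rewrite mulr_gt0// mulr_gt0.
(* The 2 counts two errors, one from [B] and one from [C], each at most [r * e * v Z y] times both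
   measures. *)
exists K, (2 * r * K1); split => //.
move=> Z xiZ; have [mv v0 vI vd] := vxi _ xiZ.
have [mTZ _ _ _] := imxi _ xiZ.
have mZ := mxi _ xiZ.
pose J B := pr mu (Z `&` T @^-1` B).
have JE B : measurable B -> B `<=` T @` Z -> (J B)%:E = (\int[mu]_(x in B) (v Z x)%:E)%E.
  move=> mB BTZ; rewrite /J -prE; last by apply: measurableI => //; exact: mTpre.
  by rewrite vI// setIidl.
have mvB B : measurable B -> B `<=` T @` Z -> measurable_fun B (fun x => (v Z x)%:E : \bar R).
  move=> mB BTZ; apply/measurable_EFinP.
  exact: (measurable_funS mTZ BTZ mv).
have J_le B hi : measurable B -> B `<=` T @` Z -> (forall x, B x -> v Z x <= hi) -> J B <= hi * pr mu B.
  move=> mB BTZ vhi.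
  rewrite -lee_fin JE// EFinM -prE// -(integral_cst mu mB).
  apply: ge0_le_integral => //.
  - by move=> x Bx; rewrite lee_fin ltW// v0//; exact: BTZ.
  - exact: mvB.
have J_ge B lo : measurable B -> B `<=` T @` Z -> 0 <= lo -> (forall x, B x -> lo <= v Z x) -> lo * pr mu B <= J B.
  move=> mB BTZ lo0 vlo.
  rewrite -lee_fin JE// EFinM -prE// -(integral_cst mu mB).
  apply: ge0_le_integral => //; last exact: mvB.
have v_le x y : (T @` Z) x -> (T @` Z) y -> v Z x <= (1 + r * D) * v Z y.
  move=> Zx Zy; have := vd _ _ Zx Zy; have vy0 := v0 _ Zy.
  rewrite ler_norml => /andP[_ h]; rewrite -ler_pdivrMr//.
  have : r * dX x y <= r * D by rewrite ler_pM2l.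
  lra.
have JZ : J (T @` Z) = pr mu Z.
  by rewrite /J; congr (pr mu _); apply: setIidl => x Zx; exists x.
have v_leZ y : (T @` Z) y -> v Z y <= K1 * pr mu Z.
  move=> Zy; have vy0 := v0 _ Zy.
  have : v Z y / (1 + r * D) * pr mu (T @` Z) <= pr mu Z.
    rewrite -JZ; apply: J_ge => //.
      by rewrite divr_ge0 ?ltW//; lra.
    move=> x Zx; rewrite ler_pdivrMr; last by lra.
    by rewrite mulrC; exact: v_le.
  have cTZ : c <= pr mu (T @` Z) by rewrite -lee_fin -prE//; exact: cxi.
  have q0 : 0 < v Z y / (1 + r * D) by rewrite divr_gt0//; lra.
  move=> h; have : v Z y / (1 + r * D) * c <= pr mu Z.
    by apply: le_trans h; rewrite ler_pM2l.
  rewrite -ler_pdivlMr// ler_pdivrMr; last by lra.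
  suff -> : K1 * pr mu Z = pr mu Z / c * (1 + r * D) by [].
  by rewrite /K1; ring.
have [z0 Zz0] : Z !=set0.
  apply/set0P; apply/negP => /eqP Z0; have := cxi _ xiZ.
  by rewrite Z0 image_set0 measure0 lee_fin leNgt c0.
have TZz0 : (T @` Z) (T z0) by exists z0.
split.
  move=> B mB.
  have -> : pr mu (Z `&` T @^-1` B) = J (B `&` T @` Z).
    rewrite /J; congr (pr mu _); apply/seteqP; split => x /=; last by tauto.
    by move=> [Zx Bx]; split => //; split => //; exists x.
  have mBZ := measurableI _ _ mB mTZ.
  have h1 : J (B `&` T @` Z) <= (1 + r * D) * v Z (T z0) * pr mu (B `&` T @` Z).
    by apply: J_le => // x [_ Zx]; exact: v_le.
  apply: le_trans h1 _; have := v_leZ _ TZz0; have := v0 _ TZz0 => w0 w1.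
  have h2 := pr_le mu _ _ mBZ mB (@subIsetl _ _ _).
  apply: ler_pM => //.
  - by rewrite mulr_ge0 ?ltW//; lra.
  - exact: pr_ge0.
  - by rewrite /K -mulrA ler_pM2l//; lra.
move=> C e mC e0 CZ Ce B mB BC.
have [C0|/set0P[y Cy]] := eqVneq C set0.
  have -> : B = set0 by apply/seteqP; split => // x /BC; rewrite C0.
  by rewrite C0 !pr_set0 !mulr0 subrr normr0.
have vy0 := v0 _ (CZ _ Cy); have vyZ := v_leZ _ (CZ _ Cy).
have vC x : C x -> `|v Z x - v Z y| <= r * e * v Z y.
  move=> Cx; have h := vd _ _ (CZ _ Cx) (CZ _ Cy).
  have -> : v Z x - v Z y = (v Z x / v Z y - 1) * v Z y by rewrite mulrBl mul1r divfK// gt_eqF.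
  rewrite normrM (ger0_norm (ltW vy0)) ler_pM2r// (le_trans h)// ler_pM2l//; exact: Ce.
have re0 : 0 <= r * e by rewrite mulr_ge0// ltW.
have Jest B' : measurable B' -> B' `<=` C -> `|J B' - v Z y * pr mu B'| <= r * e * v Z y * pr mu B'.
  move=> mB' BC'; have BZ' : B' `<=` T @` Z by exact: subset_trans CZ.
  have h1 : J B' <= (v Z y + r * e * v Z y) * pr mu B'.
    by apply: J_le => // x /BC'/vC; rewrite ler_norml; lra.
  have h2 : (v Z y - r * e * v Z y) * pr mu B' <= J B'.
    have [h|h] := leP (v Z y - r * e * v Z y) 0.
      by apply: le_trans (pr_ge0 _ _); have := pr_ge0 mu B'; nra.
    by apply: J_ge => //; [exact: ltW|move=> x /BC'/vC; rewrite ler_norml; lra].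
  by rewrite ler_norml; apply/andP; split; lra.
have hB := Jest _ mB BC; have hC := Jest _ mC (@subset_refl _ C).
have -> : pr mu (Z `&` T @^-1` B) * pr mu C - pr mu (Z `&` T @^-1` C) * pr mu B =
  (J B - v Z y * pr mu B) * pr mu C - (J C - v Z y * pr mu C) * pr mu B.
  by rewrite /J; ring.
apply: le_trans (ler_normB _ _) _; rewrite !normrM !(ger0_norm (pr_ge0 mu _)).
have pB := pr_ge0 mu B; have pC := pr_ge0 mu C.
have h1 : `|J B - v Z y * pr mu B| * pr mu C <= r * e * v Z y * pr mu B * pr mu C.
  exact: ler_wpM2r.
have h2 : `|J C - v Z y * pr mu C| * pr mu B <= r * e * v Z y * pr mu C * pr mu B.
  exact: ler_wpM2r.
apply: le_trans (lerD h1 h2) _.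
have : r * e * v Z y * pr mu B * pr mu C <= r * e * (K1 * pr mu Z) * pr mu B * pr mu C.
  by rewrite !ler_wpM2r// ler_wpM2l.
lra.
Qed.

End Distortion.

Lemma cvg_cstM {R : realType} (f : nat -> R) (a l : R) :
  f @ \oo --> l -> (fun n => a * f n) @ \oo --> a * l.
Proof. by move=> fl; apply: cvgM => //; exact: cvg_cst. Qed.

Lemma le_cvg_seq {R : realType} (f g : nat -> R) (a b : R) :
  f @ \oo --> a -> g @ \oo --> b -> (forall n, f n <= g n) -> a <= b.
Proof.
move=> fa gb fg; rewrite -subr_ge0; apply: (cvgr_to_ge (cvgB gb fa)).
by apply: nearW => n /=; rewrite subr_ge0.
Qed.

Section Cells.
Context {R : realType} {d} {X : measurableType d} (dX : X -> X -> R).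
Context (mu : probability X R) (T : X -> X) (xi : set (set X)).
Context (GM : GibbsMarkov dX mu T xi).

Let mT : measurable_fun setT T := GM_measurable _ _ _ _ GM.
Let muT := GM_invariant _ _ _ _ GM.
Let mTpre := measurable_preimageT T mT.
Let miter := measurable_iter T mT.

Lemma cells_enum (S : set (set X)) : S `<=` xi -> exists F : nat -> set X,
  [/\ forall n, xi (F n) \/ F n = set0, trivIset setT F,
      forall n, measurable (F n) & \bigcup_n F n = \bigcup_(Z in S) Z].
Proof.
move=> Sxi; have [_ _ [[[cxi disj _] _] _] _ _] := GM.
have /countable_injP[f finj] : countable S by exact: sub_countable (subset_card_le Sxi) cxi.
pose F n := \bigcup_(Z in [set Z | S Z /\ f Z = n]) Z.
have FE Z : S Z -> F (f Z) = Z.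
  move=> SZ; apply/seteqP; split => x /=; last by exists Z.
  by move=> [Z' [SZ' fZ] Z'x]; rewrite -(finj _ _ _ _ fZ)// inE.
have F_or n : xi (F n) \/ F n = set0.
  have [[Z SZ <-]|nZ] := pselect (exists2 Z, S Z & f Z = n).
    by left; rewrite FE//; exact: Sxi.
  by right; apply/seteqP; split => // x [Z [SZ fZ]]; case: nZ; exists Z.
exists F; split => //.
- move=> i j _ _ [x [[Z [SZ fZ] Zx] [Z' [SZ' fZ'] Zx']]].
  rewrite -fZ -fZ'; congr (f _); apply: contrapT => ZZ'.
  by have : (Z `&` Z') x by []; rewrite disj//; exact: Sxi.
- by move=> n; case: (F_or n) => [/(GM_cell_measurable _ _ _ _ GM)|->].
- apply/seteqP; split => x.
    by move=> [n _ [Z [SZ _] Zx]]; exists Z.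
  by move=> [Z SZ Zx]; exists (f Z) => //; rewrite FE.
Qed.

Lemma xi_measurable_cvg (D : set X) : measurable D -> xi_measurable mu xi D ->
  exists F : nat -> set X, (forall n, xi (F n) \/ F n = set0) /\
    forall B, measurable B ->
    (fun n => \sum_(0 <= i < n) pr mu (F i `&` B)) @ \oo --> pr mu (D `&` B).
Proof.
move=> mD [S Sxi muS]; have [F [F_or tF mF FS]] := cells_enum S Sxi.
exists F; split => // B mB.
have mU : measurable (\bigcup_n F n) by exact: bigcup_measurable.
have -> : pr mu (D `&` B) = pr mu (\bigcup_n (F n `&` B)).
  rewrite -setI_bigcupl; rewrite -FS in muS.
  have pS E : measurable E ->
     E `<=` (D `\` \bigcup_n F n) `|` (\bigcup_n F n `\` D) -> pr mu E = 0.
    move=> mE ES; apply/eqP; rewrite eq_le pr_ge0 andbT.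
    have <- : pr mu ((D `\` \bigcup_n F n) `|` (\bigcup_n F n `\` D)) = 0 by rewrite /pr muS.
    by apply: pr_le => //; apply: measurableU; exact: measurableD.
  have mDB := measurableI _ _ mD mB; have mUB := measurableI _ _ mU mB.
  rewrite (pr_split mu _ _ mDB mUB) (pr_split mu _ _ mUB mDB).
  rewrite (pS (_ `\` _)); last 2 first.
  - exact: measurableD.
  - by move=> x /=; tauto.
  rewrite (pS (_ `\` _)); last 2 first.
  - exact: measurableD.
  - by move=> x /=; tauto.
  by rewrite setIC.
apply: pr_bigcup_cvg; first by move=> n; exact: measurableI.
by move=> i j _ _ [x [[Fi _] [Fj _]]]; apply: tF => //; exists x.
Qed.

(** Summation over the cells. The three coefficients let one statement transport the upper bound and
    both sides of the distortion estimate. *)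
Lemma xi_measurable_le (D B1 B2 : set X) (a b c : R) :
  measurable D -> xi_measurable mu xi D -> measurable B1 -> measurable B2 ->
  (forall Z, xi Z -> a * pr mu (Z `&` B1) <= b * pr mu Z + c * pr mu (Z `&` B2)) ->
  a * pr mu (D `&` B1) <= b * pr mu D + c * pr mu (D `&` B2).
Proof.
move=> mD xiD mB1 mB2 hZ; have [F [F_or Fcvg]] := xi_measurable_cvg _ mD xiD.
have h1 := cvg_cstM _ a _ (Fcvg _ mB1).
have h0 := cvg_cstM _ b _ (Fcvg _ measurableT).
have h2 := cvg_cstM _ c _ (Fcvg _ mB2).
rewrite setIT in h0.
apply: (le_cvg_seq _ _ _ _ h1 (cvgD h0 h2)) => n /=.
rewrite fctE/= !mulr_sumr -big_split/=; apply: ler_sum => i _.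
rewrite setIT; case: (F_or i) => [|->]; first exact: hZ.
by rewrite !set0I !pr_set0 !mulr0 addr0.
Qed.

(** On such a set every branch can be treated alike: an image that meets [C] covers it, so
    distortion applies on all of [C], and an image that misses [C] contributes 0. *)
Definition Markov_cell (C : set X) :=
  forall Z, xi Z -> T @` Z `&` C !=set0 -> C `<=` T @` Z.

Lemma xi_measurable_distortion : exists K r : R, [/\ 0 < K, 0 < r &
  forall D, measurable D -> xi_measurable mu xi D ->
  (forall B, measurable B -> pr mu (D `&` T @^-1` B) <= K * pr mu D * pr mu B) /\
  (forall C e, measurable C -> 0 <= e -> Markov_cell C ->
     (forall x y, C x -> C y -> dX x y <= e) ->
     forall B, measurable B -> B `<=` C ->
     `|pr mu (D `&` T @^-1` B) * pr mu C - pr mu (D `&` T @^-1` C) * pr mu B|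
       <= r * e * pr mu D * pr mu B * pr mu C)].
Proof.
have [K [r [K0 r0 Kr]]] := GM_distortion _ _ _ _ GM.
exists K, r; split => // D mD xiD; split.
  move=> B mB; have mTB := mTpre _ mB.
  have := xi_measurable_le D (T @^-1` B) set0 1 (K * pr mu B) 0 mD xiD mTB measurable0.
  rewrite !mul0r !addr0 !mul1r mulrAC; apply=> Z xiZ.
  by rewrite mul0r addr0 mul1r mulrAC; exact: (Kr _ xiZ).1.
move=> C e mC e0 MC Ce B mB BC.
have mTB := mTpre _ mB; have mTC := mTpre _ mC.
have hZ Z : xi Z -> `|pr mu (Z `&` T @^-1` B) * pr mu C - pr mu (Z `&` T @^-1` C) * pr mu B|
       <= r * e * pr mu Z * pr mu B * pr mu C.
  move=> xiZ; have [TZC|TZC] := pselect (T @` Z `&` C !=set0).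
    by apply: (Kr _ xiZ).2 => //; exact: MC.
  have e1 B' : B' `<=` C -> Z `&` T @^-1` B' = set0.
    move=> BC'; apply/seteqP; split => // x [Zx Bx]; apply: TZC; exists (T x).
    by split; [exists x|exact: BC'].
  by rewrite !e1// pr_set0 !mul0r subrr normr0 !mulr_ge0 ?pr_ge0// ltW.
have h1 := xi_measurable_le D (T @^-1` B) (T @^-1` C) (pr mu C) (r * e * pr mu B * pr mu C) (pr mu B) mD xiD mTB mTC.
have h2 := xi_measurable_le D (T @^-1` C) (T @^-1` B) (pr mu B) (r * e * pr mu B * pr mu C) (pr mu C) mD xiD mTC mTB.
rewrite ler_norml; apply/andP; split.
  suff: pr mu B * pr mu (D `&` T @^-1` C) <=
    r * e * pr mu B * pr mu C * pr mu D + pr mu C * pr mu (D `&` T @^-1` B) by lra.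
  by apply: h2 => Z /hZ; rewrite ler_norml => /andP[h _]; lra.
suff: pr mu C * pr mu (D `&` T @^-1` B) <=
    r * e * pr mu B * pr mu C * pr mu D + pr mu B * pr mu (D `&` T @^-1` C) by lra.
by apply: h1 => Z /hZ; rewrite ler_norml => /andP[_ h]; lra.
Qed.

Lemma contraction_iter : exists N : nat, exists rho : R, exists M : R,
  [/\ (1 <= N)%N, 0 < rho < 1, 0 <= M & forall k x y,
    (forall i, (i < k * N)%N -> exists2 Z, xi Z & Z (iter i T x) /\ Z (iter i T y)) ->
    dX x y <= rho ^+ k * M].
Proof.
case: GM => -[metX [[D DX] _]] _ _ _ [[N [rho [N1 rho0 rho1 hN]]] _ _].
exists N, rho, (Num.max D 0); split => //; rewrite ?rho0// ?le_max ?lexx ?orbT//.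
elim=> [|k IH] x y; first by rewrite expr0 mul1r le_max DX.
rewrite mulSn => h; apply: le_trans (hN _ _ _) _.
  by move=> i iN; apply: h; rewrite (leq_trans iN)// leq_addr.
rewrite exprS -mulrA ler_pM2l//; apply: IH => i ik.
by rewrite -!iterD addnC; apply: h; rewrite ltn_add2l.
Qed.

(** Cylinders over finitely many cells. Their length controls the diameter through the contraction,
    the number of cells controls the uncovered mass, and the Markov property holds because each
    cylinder lies in a single cell or is empty. *)
Lemma small_Markov_cells (del eps : R) : 0 < del -> 0 < eps ->
  exists (I : finType) (C : I -> set X), [/\
    forall i, measurable (C i), forall i j, i <> j -> C i `&` C j = set0,
    forall i, Markov_cell (C i), forall i x y, C i x -> C i y -> dX x y <= del &
    pr mu (~` \big[setU/set0]_(i <- enum I) C i) <= eps].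
Proof.
move=> del0 eps0.
have [N [rho [M [N1 /andP[rho0 rho1] M0 hN]]]] := contraction_iter.
(* The exponent [k.+1] keeps the cylinder length [n] positive, so that a cylinder has a first
   cell. *)
have [k hk] : exists k, rho ^+ k.+1 * M <= del.
  have : (fun k => rho ^+ k * M) @ \oo --> 0 * M.
    by apply: cvgM; [apply: cvg_expr; rewrite ger0_norm// ltW|exact: cvg_cst].
  rewrite mul0r => /cvgr0Pnorm_le /(_ _ del0) [k _ hk]; exists k.
  by apply: le_trans (ler_norm _) _; apply: hk => /=.
pose n := (k.+1 * N)%N.
have n0 : (0 < n)%N by rewrite muln_gt0.
have [F [F_or tF mF FS]] := cells_enum xi (@subset_refl _ xi).
have pF : pr mu (\bigcup_n F n) = 1.
  have [_ _ [[[_ _ xi0] _] _] _ _] := GM.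
  have mU : measurable (\bigcup_n F n) by exact: bigcup_measurable.
  have := pr_setC mu _ mU; rewrite {1}FS {1}/pr xi0 /=; lra.
(* An orbit may leave the chosen cells at any of [n] times, each of which costs the same by
   invariance. *)
have epsn : 0 < eps / n%:R by rewrite divr_gt0// ltr0n.
have [m hm] : exists m, 1 - eps / n%:R <= \sum_(0 <= i < m) pr mu (F i).
  have := pr_bigcup_cvg mu F mF tF; rewrite pF => /cvgrPdist_le /(_ _ epsn) [m _ hm].
  exists m; have := hm m (leqnn m); rewrite ler_norml => /andP[_]; lra.
pose U := \big[setU/set0]_(i <- iota 0 m) F i.
have mU : measurable U by exact: bigsetU_measurable.
have pU : pr mu (~` U) <= eps / n%:R.
  have := pr_bigsetU mu _ (iota 0 m) F setT measurableT mF _ (iota_uniq 0 m).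
  rewrite pr_setT setTD -/U; under eq_bigr do rewrite setTI.
  rewrite /index_iota subn0 in hm => h.
  suff h' : 1 = \sum_(i <- iota 0 m) pr mu (F i) + pr mu (~` U) by lra.
  apply: h => i j ij; apply/seteqP; split => // x Fx; apply: ij; apply: tF => //.
  by exists x.
pose C (w : {ffun 'I_n -> 'I_m}) := [set x | forall i, F (w i) (iter i T x)].
have mC w : measurable (C w).
  rewrite (_ : C w = \bigcap_(i in [set: 'I_n]) iter i T @^-1` F (w i)).
    by apply: fin_bigcap_measurable => // i _; exact: miter.
  by apply/seteqP; split => x /= h i; [move=> _|]; exact: h.
exists {ffun 'I_n -> 'I_m}, C; split => //.
- move=> w w' ww'; apply/seteqP; split => // x [wx wx']; apply: ww'.
  apply/ffunP => i; apply/val_inj; apply: tF => //; exists (iter i T x).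
  by split; [exact: wx|exact: wx'].
- move=> w Z xiZ [y [TZy Cy]] x Cx.
  have [xiF|F0] := F_or (w (Ordinal n0)); last by have := Cy (Ordinal n0); rewrite F0.
  have [_ _ _ Mark _] := GM.
  apply: (Mark _ _ xiZ xiF); last exact: (Cx (Ordinal n0)).
  by exists y; split => //; exact: (Cy (Ordinal n0)).
- move=> w x y Cx Cy; apply: le_trans (hN k.+1 _ _ _) hk => i ik.
  have [xiF|F0] := F_or (w (Ordinal ik)); last by have := Cy (Ordinal ik); rewrite F0.
  exists (F (w (Ordinal ik))); first exact: xiF.
  by split; [exact: (Cx (Ordinal ik))|exact: (Cy (Ordinal ik))].
have sub : ~` (\big[setU/set0]_(w <- enum {ffun 'I_n -> 'I_m}) C w) `<=`
  \big[setU/set0]_(i <- iota 0 n) (iter i T @^-1` (~` U)).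
  move=> x nC; apply: contrapT => nU; apply: nC.
  have hU (i : 'I_n) : exists j : 'I_m, F j (iter i T x).
    apply: contrapT => nj; apply: nU; rewrite -bigcup_seq; exists (i : nat).
      by rewrite /= mem_iota add0n ltn_ord.
    move=> /=; rewrite /U -bigcup_seq => -[j /=]; rewrite mem_iota add0n => jm Fj.
    by apply: nj; exists (Ordinal jm).
  have [w hw] := choice hU.
  rewrite -bigcup_seq; exists (finfun w); first by rewrite /= mem_enum.
  by move=> i; rewrite ffunE.
have mUi i : measurable (iter i T @^-1` (~` U)) by apply: miter; exact: measurableC.
apply: (le_trans (pr_le mu _ _ _ _ sub)).
- by apply: measurableC; exact: bigsetU_measurable.
- exact: bigsetU_measurable.
apply: (le_trans (pr_bigsetU_le mu _ _ _ mUi)).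
rewrite (eq_bigr (fun=> pr mu (~` U))); last first.
  by move=> i _; apply: pr_iter => //; exact: measurableC.
rewrite big_const_seq count_predT size_iota iter_addr_0 -mulr_natl.
by rewrite mulrC -ler_pdivlMr// ltr0n.
Qed.

End Cells.

(** * First entrances *)

(** For [W] inside [A], this is the event [E n W] of the overview. The existential over [k] discards
    orbits that never enter [A], so the default value of [retime] does not interfere. *)
Definition hit_after {X : Type} (T : X -> X) (A : set X) (n : nat) (W : set X) : set X :=
  [set x | exists k, [/\ (n < k)%N, W (iter k T x) &
    forall i, (0 < i < k)%N -> ~ A (iter i T x)]].

Section HitAfter.
Context {X : Type} (T : X -> X) (A W : set X) (WA : W `<=` A).

(** A first entrance of the orbit of [T x] is one of the orbit of [x] delayed by 1, unless [T x] is
    already in [A]. The exception has measure at most [mu A], which is the source of near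
    invariance. *)
Lemma hit_after_preimage n :
  T @^-1` hit_after T A n W = hit_after T A n.+1 W `|` T @^-1` (A `&` hit_after T A n W).
Proof.
apply/seteqP; split => x /=.
  move=> h; have [ATx|nATx] := pselect (A (T x)); first by right.
  left; case: h => k [nk Wk Ak]; exists k.+1; split => //; first by rewrite iterSr.
  by move=> [//|[|i]] // ik; rewrite iterSr; exact: Ak.
move=> [|[]//] [[|k] [nk Wk Ak]] //; exists k; rewrite -iterSr; split => //.
by move=> i ik; rewrite -iterSr; apply: Ak; lia.
Qed.

Lemma hit_after0 : hit_after T A 0 W = hit_after T A 1 W `|` T @^-1` W.
Proof.
apply/seteqP; split => x /=.
  by move=> [[|[|k]] [k0 Wk Ak]] //; [right|left; exists k.+2].
move=> [[k [k0 Wk Ak]]|Wx]; first by exists k; split => //; exact: ltnW.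
by exists 1%N; split => // i; case: i => [|[]].
Qed.

Lemma hit_after_miss n x : hit_after T A n.+1 W x -> ~ A (T x).
Proof. by move=> [k [nk _ /(_ 1%N)]]; apply; rewrite (leq_trans _ nk). Qed.

Lemma hit_after_anti m n : (m <= n)%N -> hit_after T A n W `<=` hit_after T A m W.
Proof. by move=> mn x [k [nk Wk Ak]]; exists k; split => //; exact: leq_ltn_trans nk. Qed.

Lemma hit_afterD n : hit_after T A n W `\` hit_after T A n.+1 W `<=` iter n.+1 T @^-1` A.
Proof.
move=> x [[k [nk Wk Ak]] nE]; have [->|kn] := eqVneq n.+1 k; first exact: WA.
by case: nE; exists k; split => //; rewrite ltn_neqAle kn.
Qed.

End HitAfter.

(** * Asymptotic independence from unions of cells *)

Section Mixing.
Context {R : realType} {d} {X : measurableType d} (dX : X -> X -> R).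
Context (mu : probability X R) (T : X -> X) (xi : set (set X)).
Context (GM : GibbsMarkov dX mu T xi) (ergT : ergodic mu T).

Let mT : measurable_fun setT T := GM_measurable _ _ _ _ GM.
Let muT := GM_invariant _ _ _ _ GM.
Let mTpre := measurable_preimageT T mT.

(* On a small Markov cell the image under [T] of the conditional measure on a
   [xi]-measurable set is nearly proportional to [mu], so finitely many
   instances of [invariant_sets_mixing] suffice, uniformly in [D]. *)
Lemma xi_measurable_mixing (H D : nat -> set X) :
  (forall l, measurable (H l)) ->
  (fun l => pr mu (T @^-1` H l `\` H l)) @ \oo --> (0 : R) ->
  (forall l, measurable (D l)) -> (forall l, xi_measurable mu xi (D l)) ->
  forall e, 0 < e -> \forall l \near \oo,
    `|pr mu (D l `&` T @^-1` H l) - pr mu (D l) * pr mu (H l)| <= e * pr mu (D l).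
Proof.
move=> mH H0 mD xiD e e0.
have [K [r [K0 r0 Kr]]] := xi_measurable_distortion _ _ _ _ GM.
(* Four errors occur: distortion on the cells, mixing on the cells, and the uncovered part once in
   each of the two terms compared. *)
have e4 : 0 < e / 4 by rewrite divr_gt0.
have del0 : 0 < e / 4 / r by rewrite divr_gt0.
have eps0 : 0 < e / 4 / K by rewrite divr_gt0.
have [I [C [mC dC MC diamC pC]]] := small_Markov_cells _ _ _ _ GM _ _ del0 eps0.
have : \forall l \near \oo, forall i : I,
    `|pr mu (H l `&` C i) - pr mu (C i) * pr mu (H l)| <= e / 4 * pr mu (C i).
  apply: filter_forall => i.
  have [Ci0|Ci0] := eqVneq (pr mu (C i)) 0.
    apply: nearW => l; rewrite Ci0 mul0r mulr0 subr0 normr_le0 eq_le pr_ge0 andbT -Ci0; apply: pr_le => //.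
    exact: measurableI.
  have Cpos : 0 < e / 4 * pr mu (C i) by rewrite mulr_gt0// lt_neqAle eq_sym Ci0 pr_ge0.
  have /cvgr0Pnorm_le/(_ _ Cpos) := invariant_sets_mixing mu T mT muT H ergT mH H0 _ (mC i).
  by apply: filterS => l; rewrite setIC.
apply: filterS => l hl.
have [K1 K2] := Kr _ (mD l) (xiD l).
move: (H l) (D l) (mH l) (mD l) hl K1 K2 => {H0}H' D' {}mH {}mD hl K1 K2.
have mTH := mTpre _ mH; have mTC i := mTpre _ (mC i).
have mHC i := measurableI _ _ mH (mC i).
set dd := pr mu D'; set h := pr mu H'.
pose q i := pr mu (D' `&` T @^-1` C i).
pose b i := pr mu (H' `&` C i).
pose j i := pr mu (D' `&` T @^-1` H' `&` T @^-1` C i).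
have dd0 : 0 <= dd by exact: pr_ge0.
(* Distortion compares [j i] with [q i * b i / mu (C i)], and mixing compares [b i] with
   [mu (C i) * h]. *)
have hi i : `|j i - q i * h| <= e / 4 * dd * b i + e / 4 * q i.
  have q0 : 0 <= q i by exact: pr_ge0.
  have b0 : 0 <= b i by exact: pr_ge0.
  have jE : j i = pr mu (D' `&` T @^-1` (H' `&` C i)).
    by rewrite /j preimage_setI setIA.
  have := K2 (C i) (e / 4 / r) (mC i) (ltW del0) (MC i) (diamC i) _ (mHC i) (@subIsetr _ _ _).
  rewrite -jE -/(q i) -/(b i) -/dd (mulrC r) divfK ?gt_eqF//.
  have := hl i; rewrite -/(b i) -/h.
  (* A null cell cannot be divided out; there [b i], [j i] and [q i] all vanish. *)
  have [Ci0|Ci0] := eqVneq (pr mu (C i)) 0.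
    have b00 : b i = 0.
      by apply/eqP; rewrite eq_le b0 andbT -Ci0; apply: pr_le.
    have -> : j i = 0.
      apply/eqP; rewrite eq_le pr_ge0 andbT jE (le_trans (K1 _ (mHC i)))//.
      by rewrite -/(b i) b00 mulr0.
    have -> : q i = 0.
      apply/eqP; rewrite eq_le pr_ge0 andbT (le_trans (K1 _ (mC i)))//.
      by rewrite Ci0 mulr0.
    by move=> _ _; rewrite b00 !mulr0 mul0r subrr normr0 addr0.
  have cpos : 0 < pr mu (C i) by rewrite lt_neqAle eq_sym Ci0 pr_ge0.
  move: (pr mu (C i)) cpos => c cpos h1 h2.
  rewrite -(ler_pM2r cpos) -{1}(ger0_norm (ltW cpos)) -normrM.
  have -> : (j i - q i * h) * c = (j i * c - q i * b i) + q i * (b i - c * h) by ring.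
  apply: le_trans (ler_normD _ _) _; rewrite normrM (ger0_norm q0).
  have : q i * `|b i - c * h| <= q i * (e / 4 * c) by exact: ler_wpM2l.
  lra.
have mU : measurable (\big[setU/set0]_(i <- enum I) C i) by exact: bigsetU_measurable.
have uI : uniq (enum I) by exact: enum_uniq.
have dTC i i' : i <> i' -> T @^-1` C i `&` T @^-1` C i' = set0.
  by move=> /dC; rewrite -preimage_setI => ->; rewrite preimage_set0.
have TU : \big[setU/set0]_(i <- enum I) (T @^-1` C i) = T @^-1` (\big[setU/set0]_(i <- enum I) C i).
  by rewrite -!bigcup_seq preimage_bigcup.
have eb := pr_bigsetU mu _ (enum I) C H' mH mC dC uI.
have eq_ := pr_bigsetU mu _ (enum I) (fun i => T @^-1` C i) D' mD mTC dTC uI.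
have ej := pr_bigsetU mu _ (enum I) (fun i => T @^-1` C i) (D' `&` T @^-1` H') (measurableI _ _ mD mTH) mTC dTC uI.
rewrite TU in eq_ ej.
set U := \big[setU/set0]_(i <- enum I) C i in mU pC eb eq_ ej.
have mTU := mTpre _ mU.
have rem : pr mu (D' `\` T @^-1` U) <= e / 4 * dd.
  have h1 := K1 _ (measurableC mU).
  have : K * pr mu D' * pr mu (~` U) <= K * pr mu D' * (e / 4 / K).
    by apply: ler_wpM2l => //; rewrite mulr_ge0// ltW.
  have -> : K * pr mu D' * (e / 4 / K) = e / 4 * dd.
    by rewrite /dd; field; rewrite gt_eqF.
  by move=> h2; rewrite setDE preimage_setC; exact: le_trans h1 h2.
have rem' : pr mu ((D' `&` T @^-1` H') `\` T @^-1` U) <= pr mu (D' `\` T @^-1` U).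
  apply: pr_le; [|exact: measurableD|by move=> x /=; tauto].
  by apply: measurableD => //; exact: measurableI.
have h01 : 0 <= h <= 1 by rewrite pr_ge0 pr_le1.
have sum_h : `|\sum_(i <- enum I) j i - (\sum_(i <- enum I) q i) * h| <=
    e / 4 * dd * \sum_(i <- enum I) b i + e / 4 * \sum_(i <- enum I) q i.
  rewrite mulr_suml -sumrB !mulr_sumr -big_split/=.
  by apply: le_trans (ler_norm_sum _ _ _) _; apply: ler_sum => i _; exact: hi.
have p1 := pr_ge0 mu (H' `\` U).
have p2 := pr_ge0 mu (D' `\` T @^-1` U).
have p3 := pr_ge0 mu ((D' `&` T @^-1` H') `\` T @^-1` U).
rewrite -/h in eb.
move: eb eq_ ej sum_h; rewrite -/dd.
change (\sum_(i <- enum I) pr mu (H' `&` C i)) with (\sum_(i <- enum I) b i).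
change (\sum_(i <- enum I) pr mu (D' `&` T @^-1` C i)) with (\sum_(i <- enum I) q i).
change (\sum_(i <- enum I) pr mu (D' `&` T @^-1` H' `&` T @^-1` C i)) with (\sum_(i <- enum I) j i).
move: (\sum_(i <- enum I) b i) (\sum_(i <- enum I) q i) (\sum_(i <- enum I) j i).
move: p1 p2 p3 rem rem'.
move: (pr mu (H' `\` U)) (pr mu (D' `\` T @^-1` U)) (pr mu ((D' `&` T @^-1` H') `\` T @^-1` U)).
move=> u1 u2 u3 u10 u20 u30 u2e u32 sb sq sj hb dq -> hs.
have : e / 4 * dd * sb <= e / 4 * dd.
  by rewrite ler_piMr//; [rewrite mulr_ge0// ltW|lra].
have : e / 4 * sq <= e / 4 * dd by rewrite ler_pM2l//; lra.
move: hs; rewrite !ler_norml => /andP[hs1 hs2] t1 t2.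
have : u2 * h <= u2 by rewrite ler_piMr//; lra.
have : 0 <= u2 * h by rewrite mulr_ge0//; lra.
have -> : dd * h = sq * h + u2 * h by rewrite dq; ring.
by move=> t3 t4; apply/andP; split; lra.
Qed.

End Mixing.

Section HitMeasure.
Context {R : realType} {d} {X : measurableType d} (mu : probability X R).
Context (T : X -> X) (mT : measurable_fun setT T).
Context (muT : forall B, measurable B -> mu (T @^-1` B) = mu B).
Context (A W : set X) (mA : measurable A) (mW : measurable W) (WA : W `<=` A).

Lemma measurable_hit_after n : measurable (hit_after T A n W).
Proof.
rewrite (_ : hit_after T A n W = \bigcup_(k in [set k | (n < k)%N])
  (iter k T @^-1` W `&` \bigcap_(i in [set i | (0 < i < k)%N]) iter i T @^-1` (~` A))).
  apply: bigcup_measurable => k _; apply: measurableI.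
    exact: measurable_iter.
  apply: bigcap_measurableType => i _; apply: measurable_iter => //.
  exact: measurableC.
apply/seteqP; split => x /=.
  by move=> [k [nk Wk Ak]]; exists k.
by move=> [k nk [Wk Ak]]; exists k.
Qed.

Lemma pr_hit_afterS n :
  pr mu (hit_after T A n W) = pr mu (hit_after T A n.+1 W) + pr mu (A `&` hit_after T A n W).
Proof.
have mE := measurable_hit_after.
rewrite -{1}(pr_preimageT mu T muT _ (mE n)) hit_after_preimage prU//.
- by rewrite pr_preimageT//; exact: measurableI.
- by apply: measurable_preimageT => //; exact: measurableI.
- by apply/seteqP; split => // x [h [Ax _]]; exact: (hit_after_miss _ _ _ _ _ h Ax).
Qed.

(** Both [E 0] and [T^-1 (E 0)] contain [E 1]. The remainders are the preimages of [W] and of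
    [A & E 0], and they have equal measure by invariance. *)
Lemma pr_hit_after0 : pr mu (A `&` hit_after T A 0 W) = pr mu W.
Proof.
have := pr_hit_afterS 0; rewrite hit_after0 {1}prU ?pr_preimageT//.
- rewrite -hit_after0; lra.
- exact: measurable_hit_after.
- exact: measurable_preimageT.
- by apply/seteqP; split => // x [h /WA Ax]; exact: (hit_after_miss _ _ _ _ _ h Ax).
Qed.

Lemma pr_hit_after_preimageD n :
  pr mu (T @^-1` hit_after T A n W `\` hit_after T A n W) <= pr mu A.
Proof.
have mE := measurable_hit_after.
rewrite -(pr_preimageT mu T muT A)//; apply: pr_le.
- by apply: measurableD => //; exact: measurable_preimageT.
- exact: measurable_preimageT.
move=> x []; rewrite hit_after_preimage => -[h nh|[]//].
by case: nh; apply: hit_after_anti h.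
Qed.

End HitMeasure.

(** * Asymptotics of first entrance probabilities *)

Section HitAsymptotics.
Context {R : realType} {d} {X : measurableType d} (dX : X -> X -> R).
Context (mu : probability X R) (T : X -> X) (xi : set (set X)).
Context (GM : GibbsMarkov dX mu T xi) (ergT : ergodic mu T).
Context (A : nat -> set X) (mA : forall l, measurable (A l)).
Context (Apos : forall l, 0 < pr mu (A l)).
Context (A0 : (fun l => pr mu (A l)) @ \oo --> (0 : R)).
Context (xiA : forall l, xi_measurable mu xi (A l)).

Let mT : measurable_fun setT T := GM_measurable _ _ _ _ GM.
Let muT := GM_invariant _ _ _ _ GM.
Let mTpre := measurable_preimageT T mT.
Let miter := measurable_iter T mT.

(** [xi_measurable_mixing] speaks of [T^-1 H]. Replacing it by [H] costs a visit to [A] at time 1 or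
    at time [n + 1] by a point of [D], and distortion bounds either event by [K * mu D * mu A]. The
    times [n l] are arbitrary, which later yields uniformity. *)
Lemma hit_after_mixing (W D : nat -> set X) (n : nat -> nat) :
  (forall l, measurable (W l)) -> (forall l, W l `<=` A l) ->
  (forall l, measurable (D l)) -> (forall l, xi_measurable mu xi (D l)) ->
  forall e, 0 < e -> \forall l \near \oo,
    `|pr mu (D l `&` hit_after T (A l) (n l) (W l)) -
      pr mu (D l) * pr mu (hit_after T (A l) (n l) (W l))| <= e * pr mu (D l).
Proof.
move=> mW WA mD xiD e e0.
pose H l := hit_after T (A l) (n l) (W l).
have mE l k : measurable (hit_after T (A l) k (W l)) by exact: measurable_hit_after.
have mH l : measurable (H l) by exact: mE.
have H0 : (fun l => pr mu (T @^-1` H l `\` H l)) @ \oo --> (0 : R).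
  apply/cvgr0Pnorm_lt => eps eps0; move/cvgr0Pnorm_lt : A0 => /(_ _ eps0).
  apply: filterS => l; rewrite !ger0_norm ?pr_ge0//; apply: le_lt_trans.
  exact: pr_hit_after_preimageD.
have [K [r [K0 r0 Kr]]] := xi_measurable_distortion _ _ _ _ GM.
have e2 : 0 < e / 2 by rewrite divr_gt0.
have e2K : 0 < e / 2 / K by rewrite divr_gt0.
have h1 := xi_measurable_mixing _ _ _ _ GM ergT H D mH H0 mD xiD _ e2.
have h2 : \forall l \near \oo, pr mu (A l) <= e / 2 / K.
  move/cvgr0Pnorm_le : A0 => /(_ _ e2K); apply: filterS => l.
  by rewrite ger0_norm ?pr_ge0.
apply: filterS2 h1 h2 => l h1 h2.
have [K1 _] := Kr _ (mD l) (xiD l).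
have KA k : pr mu (D l `&` iter k.+1 T @^-1` A l) <= e / 2 * pr mu (D l).
  have mk : measurable (iter k T @^-1` A l) by exact: miter.
  have -> : iter k.+1 T @^-1` A l = T @^-1` (iter k T @^-1` A l).
    by apply/seteqP; split => x /=; rewrite -iterSr.
  apply: le_trans (K1 _ mk) _; rewrite pr_iter// mulrAC mulrC [leRHS]mulrC ler_wpM2l ?pr_ge0//.
  have := h2; rewrite ler_pdivlMr// mulrC//.
have mDE k := measurableI _ _ (mD l) (mE l k).
have mTH := mTpre _ (mH l).
have f1 := pr_split mu _ _ (measurableI _ _ (mD l) mTH) (mE l (n l).+1).
have f2 := pr_split mu _ _ (measurableI _ _ (mD l) (mH l)) (mE l (n l).+1).
have eE : D l `&` T @^-1` H l `&` hit_after T (A l) (n l).+1 (W l) =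
          D l `&` H l `&` hit_after T (A l) (n l).+1 (W l).
  apply/seteqP; split => x [[Dx Hx] Ex]; split => //; split => //.
    by apply: hit_after_anti Ex.
  by rewrite hit_after_preimage; left.
rewrite eE in f1.
have g1 : pr mu (D l `&` T @^-1` H l `\` hit_after T (A l) (n l).+1 (W l)) <= e / 2 * pr mu (D l).
  apply: le_trans (KA 0%N); apply: pr_le.
  - by apply: measurableD => //; exact: measurableI.
  - by apply: measurableI => //; exact: (miter 1%N).
  by move=> x [[Dx]]; rewrite /H hit_after_preimage => -[//|[Ax _] _]; split.
have g2 : pr mu (D l `&` H l `\` hit_after T (A l) (n l).+1 (W l)) <= e / 2 * pr mu (D l).
  apply: le_trans (KA (n l)); apply: pr_le.
  - by apply: measurableD => //; exact: measurableI.
  - by apply: measurableI => //; exact: miter.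
  by move=> x [[Dx Hx] nE]; split => //; exact: (hit_afterD T (A l) (W l) (WA l)).
have p1 := pr_ge0 mu (D l `&` T @^-1` H l `\` hit_after T (A l) (n l).+1 (W l)).
have p2 := pr_ge0 mu (D l `&` H l `\` hit_after T (A l) (n l).+1 (W l)).
move: h1; rewrite -/(H l) !ler_norml => /andP[h3 h4]; apply/andP; split; lra.
Qed.

(** One step of the recursion has error at most [e / 2 * mu A], and each further step damps it by
    [1 - mu A]; the accumulated error stays below [e / 2] for every [n]. The other half of [e] pays
    for the initial value. *)
Lemma hit_after_asymptotic (W : nat -> set X) :
  (forall l, measurable (W l)) -> (forall l, W l `<=` A l) ->
  forall e, 0 < e -> \forall l \near \oo, forall n,
    `|pr mu (hit_after T (A l) n (W l)) -
      (1 - pr mu (A l)) ^+ n * (pr mu (W l) / pr mu (A l))| <= e.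
Proof.
move=> mW WA e e0.
have e2 : 0 < e / 2 by rewrite divr_gt0.
pose P l n := `|pr mu (A l `&` hit_after T (A l) n (W l)) -
      pr mu (A l) * pr mu (hit_after T (A l) n (W l))| <= e / 2 * pr mu (A l).
(* uniformity in [n]: [hit_after_mixing] is applied to times violating the bound *)
pose nl l := xget 0%N [set n | ~ P l n].
have := hit_after_mixing W A nl mW WA mA xiA _ e2.
apply: filterS => l hl n.
have {hl}hP k : P l k.
  apply: contrapT => nk; have : ~ P l (nl l) by exact: (@xgetPex _ 0%N [set n | ~ P l n] (ex_intro _ k nk)).
  by apply.
have c1 := pr_le1 mu _ (mA l); have c0 := Apos l.
pose p k := pr mu (hit_after T (A l) k (W l)).
have pS k : `|p k.+1 - (1 - pr mu (A l)) * p k| <= e / 2 * pr mu (A l).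
  have := hP k; rewrite /P; have := pr_hit_afterS mu T mT muT (A l) (W l) (mA l) (mW l) k.
  rewrite -/(p k) -/(p k.+1) => e1; rewrite !ler_norml => /andP[? ?].
  by apply/andP; split; lra.
have p0 : `|p 0%N - pr mu (W l) / pr mu (A l)| <= e / 2.
  have := hP 0%N; rewrite /P pr_hit_after0// -/(p 0%N) => h.
  rewrite -(ler_pM2r c0); apply: le_trans h; rewrite -[X in _ * X <= _](gtr0_norm c0).
  by rewrite -normrM mulrBl divfK ?gt_eqF// distrC mulrC.
have pn k : `|p k - (1 - pr mu (A l)) ^+ k * p 0%N| <= e / 2.
  elim: k => [|k IH]; first by rewrite expr0 mul1r subrr normr0 ltW.
  rewrite exprS.
  have -> : p k.+1 - (1 - pr mu (A l)) * (1 - pr mu (A l)) ^+ k * p 0%N =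
    (p k.+1 - (1 - pr mu (A l)) * p k) + (1 - pr mu (A l)) * (p k - (1 - pr mu (A l)) ^+ k * p 0%N).
    by ring.
  apply: le_trans (ler_normD _ _) _; rewrite normrM (ger0_norm (_ : 0 <= 1 - pr mu (A l))); last by lra.
  have : (1 - pr mu (A l)) * `|p k - (1 - pr mu (A l)) ^+ k * p 0%N| <= (1 - pr mu (A l)) * (e / 2).
    by apply: ler_wpM2l => //; lra.
  have := pS k; lra.
have q1 : (1 - pr mu (A l)) ^+ n * `|p 0%N - pr mu (W l) / pr mu (A l)| <= 1 * (e / 2).
  by apply: ler_pM => //; [apply: exprn_ge0; lra|apply: exprn_ile1; lra].
have -> : p n - (1 - pr mu (A l)) ^+ n * (pr mu (W l) / pr mu (A l)) =
  (p n - (1 - pr mu (A l)) ^+ n * p 0%N) + (1 - pr mu (A l)) ^+ n * (p 0%N - pr mu (W l) / pr mu (A l)) by ring.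
apply: le_trans (ler_normD _ _) _; rewrite normrM (ger0_norm (_ : 0 <= (1 - pr mu (A l)) ^+ n)); last first.
  by apply: exprn_ge0; lra.
have := pn n; lra.
Qed.

End HitAsymptotics.

(** * Box probabilities *)

(** The probability that a standard exponential variable exceeds [t]; the maximum gives 1 for
    negative [t]. *)
Definition exp_tail {R : realType} (t : R) : R := expR (- Num.max t 0).

Lemma geometric_to_exp {R : realType} (c : nat -> R) (t : R) :
  (forall l, 0 < c l) -> c @ \oo --> (0 : R) ->
  (fun l => (1 - c l) ^+ Num.truncn (t / c l)) @ \oo --> exp_tail t.
Proof.
move=> cpos c0; rewrite /exp_tail; have [t0|t0] := leP t 0.
  rewrite oppr0 expR0 (_ : (fun l => _) = fun=> 1); first exact: cvg_cst.
  apply/funext => l; suff /truncn0Pn -> : ~~ (1 <= t / c l) by rewrite expr0.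
  rewrite -ltNge (le_lt_trans _ ltr01)// pmulr_lle0// invr_gt0.
  exact: cpos.
have c_lt1 : \forall l \near \oo, c l < 1.
  have /cvgr0Pnorm_lt/(_ _ ltr01) := c0; apply: filterS => l.
  by rewrite gtr0_norm.
(* The bounds rest on [exp (- c / (1 - c)) <= 1 - c <= exp (- c)]. The extra [c l] in the upper one
   pays for rounding [t / c l] down. *)
apply: (@squeeze_cvgr _ _ _ _ (fun l => expR (- (t / (1 - c l)))) (fun l => expR (c l - t))).
- apply: filterS c_lt1 => l cl1; have cl0 := cpos l.
  have tc0 : 0 <= t / c l by rewrite divr_ge0// ltW.
  have /andP[h1 h2] := truncn_itv tc0.
  rewrite ler_pdivlMr// in h1; rewrite ltr_pdivrMr// -natr1 in h2.
  move: (Num.truncn (t / c l)) h1 h2 => n h1 h2.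
  have q0 : 0 < 1 - c l by lra.
  apply/andP; split.
    apply: (@le_trans _ _ (expR (n%:R * - (c l / (1 - c l))))).
      rewrite ler_expR mulrN lerN2 mulrA ler_pM2r// invr_gt0//.
    rewrite expRM_natl; apply: lerXn2r; rewrite ?nnegrE ?expR_ge0//; first exact: ltW.
    rewrite expRN -[leRHS]invrK lef_pV2 ?posrE ?expR_gt0 ?invr_gt0//.
    rewrite [leLHS](_ : _ = 1 + c l / (1 - c l)); first exact: expR_ge1Dx.
    by field; rewrite gt_eqF.
  apply: (@le_trans _ _ (expR (n%:R * - c l))).
    rewrite expRM_natl; apply: lerXn2r; rewrite ?nnegrE ?expR_ge0//; first exact: ltW.
    exact: expR_ge1Dx.
  rewrite ler_expR; lra.
- apply: (@continuous_cvg _ _ _ _ _ _ expR); first exact: continuous_expR.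
  have h1 : (fun l => 1 - c l) @ \oo --> (1 - 0 : R) by apply: cvgB => //; exact: cvg_cst.
  rewrite subr0 in h1.
  have h2 : (fun l => - (t / (1 - c l))) @ \oo --> - (t / 1).
    by apply: cvgN; apply: cvgM; [exact: cvg_cst|apply: cvgV => //; exact: oner_neq0].
  by rewrite divr1 in h2.
- apply: (@continuous_cvg _ _ _ _ _ _ expR); first exact: continuous_expR.
  have h1 : (fun l => c l - t) @ \oo --> (0 - t : R) by apply: cvgB => //; exact: cvg_cst.
  by rewrite sub0r in h1.
Qed.

Lemma cvg_of_near_dist {R : realType} (f g : nat -> R) (a : R) :
  (forall e, 0 < e -> \forall l \near \oo, `|f l - g l| <= e) ->
  g @ \oo --> a -> f @ \oo --> a.
Proof.
move=> fg ga; have h : (fun l => f l - g l) @ \oo --> (0 : R) by apply/cvgr0Pnorm_le.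
have -> : f = (fun l => f l - g l) \+ g by apply/funext => l /=; rewrite subrK.
by rewrite -[a]add0r; exact: cvgD.
Qed.

(** The recursion peels off the first entrance and puts everything that follows into the target [W],
    as an event about the entrance point. The index [i] only shifts the data [n], [n'] and [D]. *)
Fixpoint hit_box {X : Type} (T : X -> X) (A : set X) (n n' : nat -> nat)
    (D : nat -> set X) (k i : nat) : set X :=
  if k is k'.+1 then
    let W := D i `&` hit_box T A n n' D k' i.+1 in
    hit_after T A (n i) W `\` hit_after T A (n' i) W
  else setT.

Lemma hit_after_retime {X : Type} (T : X -> X) (A W : set X) n n' x : W `<=` A ->
  (hit_after T A n W `\` hit_after T A n' W) x ->
  (n < retime T A x <= n')%N /\ W (Defs.induced T A x).
Proof.
move=> WA [[k [nk Wk Ak]] nE].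
have rk : retime T A x = k.
  apply: xget_unique.
    split; first by split; [exact: leq_ltn_trans nk|exact: WA].
    by move=> j [j1 Aj]; rewrite leqNgt; apply/negP => jk; apply: (Ak j) => //; rewrite j1.
  move=> j [[j1 Aj] jmin].
  have jk : (j <= k)%N by apply: jmin; split; [exact: leq_ltn_trans nk|exact: WA].
  apply/eqP; rewrite eqn_leq jk leqNgt; apply/negP => kj.
  by apply: (Ak j) => //; rewrite j1.
rewrite /Defs.induced rk; split => //; rewrite nk/= leqNgt; apply/negP => n'k.
by apply: nE; exists k.
Qed.

(** One inclusion is enough, since boxes are only bounded from below in the end. *)
Lemma hit_box_sub {X : Type} (T : X -> X) (A : set X) n n' (D : nat -> set X) k i x :
  (forall i, D i `<=` A) -> hit_box T A n n' D k i x ->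
  forall j, (j < k)%N ->
    (n (i + j) < retime T A (iter j (Defs.induced T A) x) <= n' (i + j))%N /\
    D (i + j)%N (iter j.+1 (Defs.induced T A) x).
Proof.
move=> DA; elim: k i x => [//|k IH] i x /= hx.
have [|h1 [h2 h3]] := hit_after_retime _ _ _ _ _ _ _ hx.
  by move=> y [/DA].
move=> [_|j jk]; first by rewrite addn0.
by have := IH i.+1 _ h3 j jk; rewrite addSnnS -!iterSr.
Qed.

Section HitBox.
Context {R : realType} {d} {X : measurableType d} (dX : X -> X -> R).
Context (mu : probability X R) (T : X -> X) (xi : set (set X)).
Context (GM : GibbsMarkov dX mu T xi) (ergT : ergodic mu T).
Context (A : nat -> set X) (mA : forall l, measurable (A l)).
Context (Apos : forall l, 0 < pr mu (A l)).
Context (A0 : (fun l => pr mu (A l)) @ \oo --> (0 : R)).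
Context (xiA : forall l, xi_measurable mu xi (A l)).
Context (t t' : nat -> R) (D : nat -> nat -> set X) (theta : nat -> R).
Context (tt' : forall i, t i <= t' i).
Context (mD : forall l i, measurable (D l i)) (DA : forall l i, D l i `<=` A l).
Context (xiD : forall l i, xi_measurable mu xi (D l i)).
Context (Dtheta : forall i,
  (fun l => pr mu (D l i) / pr mu (A l)) @ \oo --> theta i).

Let mT : measurable_fun setT T := GM_measurable _ _ _ _ GM.

Definition scaled_box l k i : set X :=
  hit_box T (A l) (fun i => Num.truncn (t i / pr mu (A l)))
    (fun i => Num.truncn (t' i / pr mu (A l))) (D l) k i.

Definition box_limit k i : R :=
  \prod_(j < k) ((exp_tail (t (i + j)) - exp_tail (t' (i + j))) * theta (i + j)).

Lemma measurable_scaled_box l k i : measurable (scaled_box l k i).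
Proof.
elim: k i => [|k IH] i; first exact: measurableT.
have mW := measurableI _ _ (mD l i) (IH i.+1).
by apply: measurableD; exact: measurable_hit_after.
Qed.

(** The two claims feed each other. The second, applied to [D l i] and the shorter box, gives the
    limit of [mu W / mu A]; [hit_after_asymptotic] turns this into the first claim for the longer
    box, and [hit_after_mixing] then gives the second. *)
Lemma scaled_box_limit k i :
  (fun l => pr mu (scaled_box l k i)) @ \oo --> box_limit k i /\
  forall B : nat -> set X, (forall l, measurable (B l)) ->
    (forall l, xi_measurable mu xi (B l)) ->
    forall e, 0 < e -> \forall l \near \oo,
    `|pr mu (B l `&` scaled_box l k i) - pr mu (B l) * box_limit k i| <= e * pr mu (B l).
Proof.
elim: k i => [|k IH] i.
  rewrite /box_limit big_ord0; split.
    by rewrite (_ : (fun l => _) = fun=> 1) ?pr_setT; [exact: cvg_cst|apply/funext => l; rewrite pr_setT].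
  move=> B mB xiB e e0; apply: nearW => l.
  by rewrite setIT mulr1 subrr normr0 mulr_ge0 ?pr_ge0// ltW.
have [_ IH2] := IH i.+1.
set h' := box_limit k i.+1 in IH2.
have hE : box_limit k.+1 i = (exp_tail (t i) - exp_tail (t' i)) * (theta i * h').
  rewrite /h' /box_limit big_ord_recl addn0 mulrA; congr (_ * _).
  by apply: eq_bigr => j _; rewrite lift0 addSnnS.
pose W l := D l i `&` scaled_box l k i.+1.
have mW l : measurable (W l) by apply: measurableI => //; exact: measurable_scaled_box.
have WA l : W l `<=` A l by move=> x [/DA].
have Wlim : (fun l => pr mu (W l) / pr mu (A l)) @ \oo --> theta i * h'.
  apply: (@cvg_of_near_dist _ _ (fun l => pr mu (D l i) / pr mu (A l) * h')); last first.
    by apply: cvgM; [exact: Dtheta|exact: cvg_cst].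
  move=> e e0; have := IH2 (D ^~ i) (mD ^~ i) (xiD ^~ i) _ e0.
  apply: filterS => l h; have c0 := Apos l.
  have -> : pr mu (W l) / pr mu (A l) - pr mu (D l i) / pr mu (A l) * h' =
    (pr mu (W l) - pr mu (D l i) * h') / pr mu (A l) by ring.
  rewrite normrM normfV (gtr0_norm c0) ler_pdivrMr// (le_trans h)// ler_pM2l//.
  exact: pr_le.
pose E l s := hit_after T (A l) (Num.truncn (s / pr mu (A l))) (W l).
have mE l s : measurable (E l s) by exact: measurable_hit_after.
have Elim s : (fun l => pr mu (E l s)) @ \oo --> exp_tail s * (theta i * h').
  apply: (@cvg_of_near_dist _ _ (fun l => (1 - pr mu (A l)) ^+ Num.truncn (s / pr mu (A l)) *
     (pr mu (W l) / pr mu (A l)))); last by apply: cvgM => //; exact: geometric_to_exp.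
  move=> e e0; have := hit_after_asymptotic _ _ _ _ GM ergT A mA Apos A0 xiA W mW WA _ e0.
  by apply: filterS => l; exact.
have Esub l : E l (t' i) `<=` E l (t i).
  by apply: hit_after_anti; apply: le_truncn; rewrite ler_pM2r ?invr_gt0.
have boxE l : scaled_box l k.+1 i = E l (t i) `\` E l (t' i) by [].
have prB l (B : set X) : measurable B -> pr mu (B `&` scaled_box l k.+1 i) =
    pr mu (B `&` E l (t i)) - pr mu (B `&` E l (t' i)).
  move=> mB; rewrite boxE.
  have := pr_split mu _ _ (measurableI _ _ mB (mE l (t i))) (mE l (t' i)).
  rewrite setIDA -setIA (_ : E l (t i) `&` E l (t' i) = E l (t' i)); last exact: setIidr.
  lra.
have box_lim : (fun l => pr mu (scaled_box l k.+1 i)) @ \oo --> box_limit k.+1 i.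
  rewrite (_ : (fun l => _) = (fun l => pr mu (E l (t i)) - pr mu (E l (t' i)))); last first.
    by apply/funext => l; rewrite -[scaled_box _ _ _]setTI prB// !setTI.
  by rewrite hE mulrBl; apply: cvgB; exact: Elim.
split => // B mB xiB e e0.
have e3 : 0 < e / 3 by rewrite divr_gt0.
have m1 := hit_after_mixing _ _ _ _ GM ergT A mA A0 W B (fun l => Num.truncn (t i / pr mu (A l))) mW WA mB xiB _ e3.
have m2 := hit_after_mixing _ _ _ _ GM ergT A mA A0 W B (fun l => Num.truncn (t' i / pr mu (A l))) mW WA mB xiB _ e3.
have m3 : \forall l \near \oo, `|box_limit k.+1 i - pr mu (scaled_box l k.+1 i)| <= e / 3.
  by move/cvgrPdist_le : box_lim; apply.
apply: filterS3 m1 m2 m3 => l; rewrite -!/(E l _) => m1 m2 m3.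
have -> : pr mu (B l `&` scaled_box l k.+1 i) - pr mu (B l) * box_limit k.+1 i =
  (pr mu (B l `&` E l (t i)) - pr mu (B l) * pr mu (E l (t i))) -
  (pr mu (B l `&` E l (t' i)) - pr mu (B l) * pr mu (E l (t' i))) -
  pr mu (B l) * (box_limit k.+1 i - pr mu (scaled_box l k.+1 i)).
  rewrite prB//; have := prB l setT measurableT; rewrite !setTI => ->; ring.
apply: le_trans (ler_normB _ _) _; rewrite normrM (ger0_norm (pr_ge0 _ _)).
have := ler_normB (pr mu (B l `&` E l (t i)) - pr mu (B l) * pr mu (E l (t i)))
  (pr mu (B l `&` E l (t' i)) - pr mu (B l) * pr mu (E l (t' i))).
have : pr mu (B l) * `|box_limit k.+1 i - pr mu (scaled_box l k.+1 i)| <= pr mu (B l) * (e / 3).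
  by apply: ler_wpM2l => //; exact: pr_ge0.
lra.
Qed.

Lemma scaled_box_sub l k x : scaled_box l k 0 x -> forall j, (j < k)%N ->
  (t j < scaled_Phi T (A l) (pr mu (A l)) x j <= t' j) /\
  D l j (iter j.+1 (Defs.induced T (A l)) x).
Proof.
move=> hx j jk.
have [/andP[h1 h2] hD] := hit_box_sub _ _ _ _ _ _ _ _ (DA l) hx j jk.
split => //; rewrite add0n in h1 h2; have c0 := Apos l.
rewrite /scaled_Phi; apply/andP; split.
  by rewrite mulrC -ltr_pdivrMr// (lt_le_trans (truncnS_gt _))// ler_nat.
by move: (retime _ _ _) h1 h2 => [//|r] _; rewrite truncn_gt_nat ler_pdivlMr// [X in X <= _ -> _]mulrC.
Qed.

End HitBox.

(** * Weak convergence from box probabilities *)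

Lemma bounded_limit_integral {R : realType} {d} {X : measurableType d}
    (mu : probability X R) (D : set X) (u : nat -> X -> R) (f : X -> R) (M : R) :
  measurable D -> (forall n, measurable_fun setT (u n)) ->
  (forall n x, `|u n x| <= M) -> (forall x, u ^~ x @ \oo --> f x) ->
  measurable_fun setT f /\
  (fun n => fine (\int[mu]_(x in D) (u n x)%:E)%E) @ \oo -->
    fine (\int[mu]_(x in D) (f x)%:E)%E.
Proof.
move=> mD mu_ uM uf.
have mf : measurable_fun setT f by apply: (measurable_fun_cvg mu_) => x _; exact: uf.
split => //.
have mfD : measurable_fun D (fun x => (f x)%:E).
  by apply/measurable_EFinP; exact: measurable_funTS.
have muD n : measurable_fun D (fun x => (u n x)%:E).
  by apply/measurable_EFinP; exact: measurable_funTS.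
have aef : {ae mu, forall x, D x -> (fun n => (u n x)%:E) @ \oo --> (f x)%:E}.
  by apply: aeW => x _; apply/fine_cvgP; split; [exact: nearW|exact: uf].
have aeM : {ae mu, forall x n, D x -> (`|(u n x)%:E| <= (EFin \o cst M) x)%E}.
  by apply: aeW => x n _; rewrite /= lee_fin.
have [intf _ h] := dominated_convergence mD muD mfD aef
  (finite_measure_integrable_cst mu M mD) aeM.
apply: fine_cvg; rewrite fineK//.
exact: integrable_fin_num.
Qed.

Lemma simple_integral {R : realType} {d} {X : measurableType d} (mu : probability X R)
    (D : set X) (I : finType) (b : I -> R) (B : I -> set X) :
  measurable D -> (forall i, 0 <= b i) -> (forall i, measurable (B i)) ->
  fine (\int[mu]_(x in D) (\sum_i b i * \1_(B i) x)%:E)%E = \sum_i b i * pr mu (D `&` B i).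
Proof.
move=> mD b0 mB.
have mind i : measurable_fun D (fun x => (\1_(B i) x)%:E : \bar R).
  by apply/measurable_EFinP; apply: measurable_funTS; exact: measurable_indic.
under eq_integral do rewrite -sumEFin; under eq_integral do under eq_bigr do rewrite EFinM.
rewrite ge0_integral_sum//; last 2 first.
- by move=> i; apply: emeasurable_funM => //; exact: measurable_cst.
- by move=> i x _; rewrite mule_ge0// lee_fin.
rewrite (eq_bigr (fun i => (b i * pr mu (D `&` B i))%:E)); first by rewrite sumEFin.
move=> i _; rewrite ge0_integralZl_EFin// integral_indic// EFinM setIC -prE//.
exact: measurableI.
Qed.

Section BoxApproximation.
Context {R : realType} {S : topologicalType} (p q : nat -> S -> R).
Context (nbhs_coord : forall y (U : set S), nbhs y U -> exists n, exists2 e : R, 0 < e &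
  forall y', (forall i, (i < n)%N -> `|p i y' - p i y| < e /\ `|q i y' - q i y| < e) -> U y').

Definition coord_box n (a a' b b' : nat -> R) : set S :=
  [set y | forall i, (i < n)%N -> a i < p i y <= a' i /\ b i < q i y <= b' i].

(** The ceiling gives intervals open on the left and closed on the right, the shape of
    [coord_box]. *)
Definition mesh_index k (r : R) : int := Num.ceil (r * k.+1%:R).

Lemma mesh_indexP k r (z : int) :
  (mesh_index k r = z) <-> ((z - 1)%:~R / k.+1%:R < r <= z%:~R / k.+1%:R).
Proof.
rewrite ltr_pdivrMr// ler_pdivlMr//; split.
  by move=> <-; exact: ceil_itv.
exact: ceil_def.
Qed.

Lemma mesh_index_close k r r' : mesh_index k r = mesh_index k r' ->
  `|r - r'| < k.+1%:R^-1.
Proof.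
move=> /mesh_indexP; set z := mesh_index k r'.
have /mesh_indexP : mesh_index k r' = z by [].
rewrite intrB mulrBl mul1r; move: (z%:~R) (k.+1%:R^-1) => a v.
by move=> /andP[h1 h2] /andP[h3 h4]; rewrite ltr_norml; apply/andP; split; lra.
Qed.

(** Subtracting [m] makes the finite index type cover the window from [-m] to [m - 1] in each of the
    first [k] coordinates. *)
Definition mesh_cell k m (w : {ffun 'I_k -> 'I_m.*2 * 'I_m.*2}) : set S :=
  [set y | forall i : 'I_k, mesh_index k (p i y) = (w i).1%:Z - m%:Z /\
                       mesh_index k (q i y) = (w i).2%:Z - m%:Z].

Definition same_cell k y : set S :=
  [set y' | forall i, (i < k)%N -> mesh_index k (p i y') = mesh_index k (p i y) /\
                                mesh_index k (q i y') = mesh_index k (q i y)].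

Lemma mesh_cell_box k m w : exists a a' b b', [/\ forall i, a i <= a' i,
  forall i, b i <= b' i & mesh_cell k m w = coord_box k a a' b b'].
Proof.
(* The default 0 beyond the first [k] coordinates is never read by [coord_box]; there it only has to
   give ordered endpoints. *)
pose z1 i : int := if insub i is Some j then (w j).1%:Z - m%:Z else 0.
pose z2 i : int := if insub i is Some j then (w j).2%:Z - m%:Z else 0.
have le_z (z : int) : (z - 1)%:~R / k.+1%:R <= z%:~R / k.+1%:R :> R.
  by rewrite ler_pM2r ?invr_gt0// ler_int; lia.
exists (fun i => (z1 i - 1)%:~R / k.+1%:R), (fun i => (z1 i)%:~R / k.+1%:R),
  (fun i => (z2 i - 1)%:~R / k.+1%:R), (fun i => (z2 i)%:~R / k.+1%:R).
split => //; apply/seteqP; split => y h.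
  move=> i ik; rewrite /z1 /z2 insubT/=; have [h1 h2] := h (Ordinal ik).
  by split; apply/mesh_indexP.
move=> i; have [] := h i (ltn_ord i); rewrite /z1 /z2 valK.
by move=> /mesh_indexP -> /mesh_indexP ->.
Qed.

Context (f : S -> R) (M : R) (f_cont : continuous f) (f_bound : forall y, 0 <= f y <= M).

Definition mesh_inf (U : set S) : R := inf (f @` U).

Lemma mesh_inf_ge0 U : 0 <= mesh_inf U.
Proof.
rewrite /mesh_inf; have [->|/set0P U0] := eqVneq (f @` U) set0; first by rewrite inf0.
by apply: lb_le_inf => // _ [y _ <-]; have /andP[] := f_bound y.
Qed.

Lemma mesh_inf_le U y : U y -> mesh_inf U <= f y.
Proof.
move=> Uy; apply: ge_inf; last by exists y.
by exists 0 => _ [z _ <-]; have /andP[] := f_bound z.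
Qed.

(** A step function with finitely many values, zero outside the window. Letting [m] grow recovers
    the infimum over the mesh cell of [y]; letting [k] grow then recovers [f y] by continuity. *)
Definition mesh_low k m y : R := \sum_w mesh_inf (mesh_cell k m w) * \1_(mesh_cell k m w) y.

Lemma mesh_low_cell k m w y : mesh_cell k m w y ->
  mesh_low k m y = mesh_inf (same_cell k y).
Proof.
move=> wy; rewrite /mesh_low (bigD1 w)//= big1 ?addr0.
  rewrite indicE mem_set// mulr1; congr mesh_inf.
  apply/seteqP; split => y' h.
    by move=> i ik; have [-> ->] := h (Ordinal ik); have [-> ->] := wy (Ordinal ik).
  by move=> i; have [-> ->] := h i (ltn_ord i); exact: wy.
move=> w' ww'; rewrite indicE memNset ?mulr0//= => wy'; move/eqP : ww'; apply.
apply/ffunP => i; have [h1 h2] := wy i; have [h3 h4] := wy' i.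
rewrite [w' i]surjective_pairing [w i]surjective_pairing; congr (_, _); apply/val_inj => /=; lia.
Qed.

Lemma mesh_low_out k m y : (forall w, ~ mesh_cell k m w y) -> mesh_low k m y = 0.
Proof. by move=> h; rewrite /mesh_low big1// => w _; rewrite indicE memNset ?mulr0. Qed.

Lemma mesh_low_bound k m y : 0 <= mesh_low k m y <= f y.
Proof.
have [[w wy]|nw] := pselect (exists w, mesh_cell k m w y).
  by rewrite (mesh_low_cell _ _ _ _ wy) mesh_inf_ge0 mesh_inf_le.
rewrite mesh_low_out; first by rewrite lexx; have /andP[] := f_bound y.
by move=> w wy; apply: nw; exists w.
Qed.

Lemma mesh_low_cvg k y : mesh_low k ^~ y @ \oo --> mesh_inf (same_cell k y).
Proof.
apply: (@cvg_of_near_dist _ _ (fun=> mesh_inf (same_cell k y))); last exact: cvg_cst.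
move=> e e0.
pose N := (\sum_(i < k) (`|mesh_index k (p i y)| + `|mesh_index k (q i y)|).+1)%N.
have hN (i : 'I_k) : (`|mesh_index k (p i y)| < N /\ `|mesh_index k (q i y)| < N)%N.
  by rewrite /N (bigD1 i)//=; split; lia.
exists N => // m /= Nm.
have ex (i : 'I_k) : exists v : 'I_m.*2 * 'I_m.*2,
    mesh_index k (p i y) = v.1%:Z - m%:Z /\ mesh_index k (q i y) = v.2%:Z - m%:Z.
  have [h1 h2] := hN i.
  have b1 : (`|(mesh_index k (p i y) + m%:Z)%R| < m.*2)%N by lia.
  have b2 : (`|(mesh_index k (q i y) + m%:Z)%R| < m.*2)%N by lia.
  by exists (Ordinal b1, Ordinal b2) => /=; split; lia.
have [w hw] := choice ex.
rewrite (mesh_low_cell _ _ (finfun w)) ?subrr ?normr0 ?ltW//.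
by move=> i; rewrite ffunE.
Qed.

Lemma mesh_inf_cvg y : (fun k => mesh_inf (same_cell k y)) @ \oo --> f y.
Proof.
apply/cvgrPdist_le => e e0.
have : nbhs y [set y' | f y - e <= f y'].
  have /cvgrPdist_le/(_ _ e0) := f_cont y; apply: filterS => y' /=.
  rewrite ler_norml => /andP[_]; lra.
move=> /nbhs_coord[n [del del0 hn]].
(* [k >= n] controls enough coordinates, and [k + 1 > 1 / del] makes the mesh finer than [del]. *)
exists (maxn n (Num.truncn del^-1)) => // k /=; rewrite geq_max => /andP[nk kdel].
have yy : same_cell k y y by [].
rewrite ger0_norm ?subr_ge0 ?mesh_inf_le// lerBlDr -lerBlDl; apply: lb_le_inf.
  by exists (f y), y.
move=> _ [y' cy <-]; apply: hn => i i_n.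
have kd : k.+1%:R^-1 <= del.
  rewrite -[leRHS]invrK lef_pV2 ?posrE ?invr_gt0//.
  by apply: le_trans (ltW (truncnS_gt _)) _; rewrite ler_nat.
have [h1 h2] := cy i (leq_trans i_n nk).
by split; apply: lt_le_trans kd; exact: mesh_index_close.
Qed.

End BoxApproximation.

Section BoundedIntegral.
Context {R : realType} {d} {X : measurableType d} (mu : probability X R).
Context (D : set X) (mD : measurable D).

Lemma bounded_integrable (u : X -> R) (M : R) : measurable_fun setT u ->
  (forall x, `|u x| <= M) -> mu.-integrable D (EFin \o u).
Proof.
move=> mu_ uM; apply: measurable_bounded_integrable => //.
- by rewrite ltey_eq fin_num_measure.
- exact: measurable_funTS.
- by exists M; split; [exact: num_real|move=> x Mx y _; exact: le_trans (uM y) (ltW Mx)].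
Qed.

Lemma le_bounded_integral (u v : X -> R) (M : R) :
  measurable_fun setT u -> measurable_fun setT v ->
  (forall x, 0 <= u x <= v x) -> (forall x, v x <= M) ->
  fine (\int[mu]_(x in D) (u x)%:E)%E <= fine (\int[mu]_(x in D) (v x)%:E)%E.
Proof.
move=> mu_ mv uv vM.
have iu : mu.-integrable D (EFin \o u).
  apply: (@bounded_integrable _ M) => // x; have /andP[u0 h] := uv x.
  by rewrite ger0_norm// (le_trans h).
have iv : mu.-integrable D (EFin \o v).
  apply: (@bounded_integrable _ M) => // x; have /andP[u0 h] := uv x.
  by rewrite ger0_norm// (le_trans u0 h).
apply: fine_le; [exact: integrable_fin_num|exact: integrable_fin_num|].
by apply: le_integral => // x _; rewrite lee_fin; have /andP[] := uv x.
Qed.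

Lemma integral_cstD (u : X -> R) (a b M : R) : measurable_fun setT u ->
  (forall x, `|u x| <= M) ->
  fine (\int[mu]_(x in D) (a + b * u x)%:E)%E =
  a * pr mu D + b * fine (\int[mu]_(x in D) (u x)%:E)%E.
Proof.
move=> mu_ uM; have iu := bounded_integrable u M mu_ uM.
have ic : mu.-integrable D (EFin \o cst a) by exact: finite_measure_integrable_cst.
have ibu : mu.-integrable D (fun x => b%:E * (u x)%:E)%E by exact: integrableZl.
under eq_integral do rewrite EFinD EFinM.
rewrite (integralD mD ic ibu) integralZl// fineD.
- rewrite (integral_cst mu mD a%:E) fineM// ?fin_num_measure// fineM//.
  exact: integrable_fin_num.
- exact: integrable_fin_num.
- by rewrite -integralZl//; exact: integrable_fin_num.
Qed.

End BoundedIntegral.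

Section BoxConvergence.
Context {R : realType} {S : topologicalType} (p q : nat -> S -> R).
Context (nbhs_coord : forall y (U : set S), nbhs y U -> exists n, exists2 e : R, 0 < e &
  forall y', (forall i, (i < n)%N -> `|p i y' - p i y| < e /\ `|q i y' - q i y| < e) -> U y').

Section Measurability.
Context {d} {X : measurableType d} (V : X -> S).
Context (mp : forall i, measurable_fun setT (fun x => p i (V x))).
Context (mq : forall i, measurable_fun setT (fun x => q i (V x))).

Lemma measurable_coord_box n a a' b b' : measurable (V @^-1` coord_box p q n a a' b b').
Proof.
rewrite (_ : _ @^-1` _ = \bigcap_(i in [set i | (i < n)%N])
  ((fun x => p i (V x)) @^-1` `]a i, a' i] `&` (fun x => q i (V x)) @^-1` `]b i, b' i])).
  apply: bigcap_measurableType => i _; apply: measurableI.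
    by rewrite -[X in measurable X]setTI; apply: mp => //; exact: measurable_itv.
  by rewrite -[X in measurable X]setTI; apply: mq => //; exact: measurable_itv.
by apply/seteqP; split => x h i /h; rewrite /= !in_itv/=.
Qed.

Lemma measurable_mesh_cell k m w : measurable (V @^-1` mesh_cell p q k m w).
Proof.
have [a [a' [b [b' [_ _ ->]]]]] := mesh_cell_box p q k m w.
exact: measurable_coord_box.
Qed.

Context (f : S -> R) (M : R) (f_cont : continuous f) (f_bound : forall y, 0 <= f y <= M).

Let mesh_lowE k m : (fun x => mesh_low p q f k m (V x)) =
  (fun x => \sum_w mesh_inf f (mesh_cell p q k m w) * \1_(V @^-1` mesh_cell p q k m w) x).
Proof. by []. Qed.

Lemma measurable_mesh_low k m : measurable_fun setT (fun x => mesh_low p q f k m (V x)).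
Proof.
rewrite mesh_lowE; apply: measurable_sum => w; apply: measurable_funM => //.
exact/measurable_indic/measurable_mesh_cell.
Qed.

Let low_norm k m x : `|mesh_low p q f k m (V x)| <= M.
Proof.
have /andP[h1 h2] := mesh_low_bound p q f M f_bound k m (V x).
by rewrite ger0_norm// (le_trans h2)//; have /andP[] := f_bound (V x).
Qed.

Let inf_norm k x : `|mesh_inf f (same_cell p q k (V x))| <= M.
Proof.
rewrite ger0_norm; last exact: mesh_inf_ge0 f_bound _.
have h : mesh_inf f (same_cell p q k (V x)) <= f (V x) by apply: mesh_inf_le f_bound _ _ _.
by apply: le_trans h _; have /andP[] := f_bound (V x).
Qed.

Lemma mesh_low_integral (mu : probability X R) (D : set X) k m : measurable D ->
  fine (\int[mu]_(x in D) (mesh_low p q f k m (V x))%:E)%E =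
  \sum_w mesh_inf f (mesh_cell p q k m w) * pr mu (D `&` V @^-1` mesh_cell p q k m w).
Proof.
move=> mD; rewrite -simple_integral//.
- by move=> w; exact: mesh_inf_ge0 f_bound _.
- exact: measurable_mesh_cell.
Qed.

(** An iterated limit of step functions on boxes is measurable as soon as the coordinates of [V]
    are, so no sigma-algebra on [S] is involved. *)
Lemma measurable_continuous_comp : measurable_fun setT (fun x => f (V x)).
Proof.
have m1 k : measurable_fun setT (fun x => mesh_inf f (same_cell p q k (V x))).
  apply: (@measurable_fun_cvg _ _ _ _ (fun m x => mesh_low p q f k m (V x))).
    by move=> m; exact: measurable_mesh_low.
  by move=> x _; exact: mesh_low_cvg.
apply: (measurable_fun_cvg m1) => x _.
exact: (mesh_inf_cvg p q nbhs_coord f M f_cont f_bound).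
Qed.

Lemma mesh_low_integral_approx (mu : probability X R) e : 0 < e -> exists k m,
  fine (\int[mu]_x (f (V x))%:E)%E - e <= fine (\int[mu]_x (mesh_low p q f k m (V x))%:E)%E.
Proof.
move=> e0; have e2 : 0 < e / 2 by rewrite divr_gt0.
have h1 k := @bounded_limit_integral _ _ _ mu setT (fun m x => mesh_low p q f k m (V x))
  (fun x => mesh_inf f (same_cell p q k (V x))) M measurableT (measurable_mesh_low k)
  (low_norm k) (fun x => mesh_low_cvg p q f k (V x)).
have [_ h2] := @bounded_limit_integral _ _ _ mu setT
  (fun k x => mesh_inf f (same_cell p q k (V x))) (fun x => f (V x)) M measurableT
  (fun k => (h1 k).1) inf_norm
  (fun x => mesh_inf_cvg p q nbhs_coord f M f_cont f_bound (V x)).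
move/cvgrPdist_le : h2 => /(_ _ e2)[k _ /(_ k (leqnn k))]; rewrite ler_norml => /andP[_ hk].
have /cvgrPdist_le/(_ _ e2)[m _ /(_ m (leqnn m))] := (h1 k).2.
rewrite ler_norml => /andP[_ hm].
exists k, m; lra.
Qed.

End Measurability.

Context {d} {X : measurableType d} (mu : probability X R) (A : nat -> set X).
Context (mA : forall l, measurable (A l)) (Apos : forall l, 0 < pr mu (A l)).
Context {dO} {O : measurableType dO} (P : probability O R).
Context (Y : nat -> X -> S) (Z : O -> S).
Context (mpY : forall l i, measurable_fun setT (fun x => p i (Y l x))).
Context (mqY : forall l i, measurable_fun setT (fun x => q i (Y l x))).
Context (mpZ : forall i, measurable_fun setT (fun x => p i (Z x))).
Context (mqZ : forall i, measurable_fun setT (fun x => q i (Z x))).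
Context (box_liminf : forall n a a' b b', (forall i, a i <= a' i) -> (forall i, b i <= b' i) ->
  forall e, 0 < e -> \forall l \near \oo,
   pr P (Z @^-1` coord_box p q n a a' b b') - e <=
   pr mu (A l `&` Y l @^-1` coord_box p q n a a' b b') / pr mu (A l)).

Lemma integral_liminf (f : S -> R) (M : R) : continuous f -> (forall y, 0 <= f y <= M) ->
  forall e, 0 < e -> \forall l \near \oo,
    fine (\int[P]_w (f (Z w))%:E)%E - e <=
    fine (\int[mu]_(x in A l) (f (Y l x))%:E)%E / pr mu (A l).
Proof.
move=> fc fM e e0; have e2 : 0 < e / 2 by rewrite divr_gt0.
have [k [m hkm]] := mesh_low_integral_approx Z mpZ mqZ f M fc fM P _ e2.
rewrite (mesh_low_integral Z mpZ mqZ f M fM) in hkm; last exact: measurableT.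
set b := fun w => mesh_inf f (mesh_cell p q k m w) in hkm.
have b0 w : 0 <= b w by exact: mesh_inf_ge0 fM _.
pose B := \sum_w b w.
have B0 : 0 <= B by apply: sumr_ge0.
(* The tolerance per cell is divided by the total weight [B] of the step function; the 1 avoids a
   division by 0. *)
have e' : 0 < e / 2 / (1 + B) by rewrite divr_gt0//; lra.
have : \forall l \near \oo, forall w, pr P (Z @^-1` mesh_cell p q k m w) - e / 2 / (1 + B) <=
    pr mu (A l `&` Y l @^-1` mesh_cell p q k m w) / pr mu (A l).
  apply: filter_forall => w; have [a [a' [c [c' [aa cc ->]]]]] := mesh_cell_box p q k m w.
  exact: box_liminf.
apply: filterS => l hl.
apply: (@le_trans _ _ (fine (\int[mu]_(x in A l) (mesh_low p q f k m (Y l x))%:E)%E / pr mu (A l))); last first.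
  rewrite ler_pM2r ?invr_gt0//.
  apply: (le_bounded_integral mu (A l) (mA l) _ _ M).
  - exact: measurable_mesh_low.
  - exact: (measurable_continuous_comp (Y l) (mpY l) (mqY l) f M).
  - by move=> x; exact: mesh_low_bound fM _ _ _.
  - by move=> x; have /andP[] := fM (Y l x).
rewrite (mesh_low_integral (Y l) (mpY l) (mqY l) f M fM)// mulr_suml.
apply: (@le_trans _ _ (\sum_w b w * (pr P (Z @^-1` mesh_cell p q k m w) - e / 2 / (1 + B)))).
  under eq_bigr do rewrite mulrBr.
  rewrite sumrB -mulr_suml -/B.
  have : B * (e / 2 / (1 + B)) <= e / 2.
    rewrite mulrA ler_pdivrMr; last by lra.
    by rewrite mulrC ler_pM2l//; lra.
  rewrite (eq_bigr (fun w => b w * pr P (Z @^-1` mesh_cell p q k m w))) in hkm; last first.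
    by move=> w _; rewrite setTI.
  lra.
by apply: ler_sum => w _; rewrite -[leRHS]mulrA; apply: ler_wpM2l; [exact: b0|exact: hl].
Qed.

(** [integral_liminf] is applied to the nonnegative functions [M + g] and [M - g]. Constants
    integrate exactly under probabilities, so the second bound is an upper bound for [g]. *)
Lemma wconv_of_boxes : wconv mu A Y P Z.
Proof.
move=> g [gc [M gM]].
have gbound s : `|s| = 1 -> forall y, 0 <= M + s * g y <= M + M.
  move=> s1 y; have : `|s * g y| <= M by rewrite normrM s1 mul1r.
  by rewrite ler_norml => /andP[? ?]; apply/andP; split; lra.
have gcont s : continuous (fun y => M + s * g y).
  move=> y; apply: cvgD; first exact: cvg_cst.
  by apply: cvgM; [exact: cvg_cst|exact: gc].
have mg d' (X' : measurableType d') (V : X' -> S) :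
    (forall i, measurable_fun setT (fun x => p i (V x))) ->
    (forall i, measurable_fun setT (fun x => q i (V x))) ->
    measurable_fun setT (fun x => g (V x)).
  move=> mpV mqV.
  have := measurable_continuous_comp V mpV mqV (fun y => M + 1 * g y) (M + M) (gcont 1) (gbound 1 (normr1 _)).
  move=> h; have := measurable_funB h (@measurable_cst _ _ _ _ setT M).
  congr measurable_fun; apply/funext => x /=; ring.
apply/cvgrPdist_le => e e0.
have n1 := integral_liminf _ _ (gcont 1) (gbound 1 (normr1 _)) _ e0.
have n2 := integral_liminf _ _ (gcont (-1)) (gbound (-1) (normrN1 _)) _ e0.
apply: filterS2 n1 n2 => l.
rewrite !(integral_cstD _ _ _ _ _ _ M)//; try exact: mg.
rewrite !pr_setT !mulr1 mulrDl mulfK ?gt_eqF// mulrDl mulfK ?gt_eqF// !mul1r !mulN1r.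
rewrite -/(pr mu (A l)) => h1 h2; rewrite ler_norml; apply/andP; split; lra.
Qed.

End BoxConvergence.

(** The boxes around [y] generate a filter that converges to [y] coordinatewise, hence in the
    product topology. *)
Lemma nbhs_ptws_coord {R : realType} (y : {ptws nat -> R}) (U : set {ptws nat -> R}) :
  nbhs y U -> exists n, exists2 e : R, 0 < e &
  forall y' : {ptws nat -> R}, (forall i, (i < n)%N -> `|y' i - y i| < e) -> U y'.
Proof.
pose box (ne : nat * R) : set {ptws nat -> R} :=
  [set y' | forall i, (i < ne.1)%N -> `|y' i - y i| < ne.2].
pose F := filter_from [set ne : nat * R | 0 < ne.2] box.
have FF : Filter F.
  apply: filter_from_filter; first by exists (0%N, 1) => /=.
  move=> [n e] [n' e'] /= e0 e0'; exists (maxn n n', Num.min e e') => /=.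
    by rewrite lt_min e0.
  by move=> y' h; split => i /= i_n; have := h i; rewrite /= leq_max i_n ?orbT lt_min => /(_ isT)/andP[].
have : {ptws, F --> y}.
  apply/pointwise_cvgP => i; apply/cvgrPdist_lt => e e0.
  exists (i.+1, e) => //= y' /(_ i (ltnSn i)); by rewrite distrC.
by move=> /(_ U) + Uy => /(_ Uy)[[n e] /= e0 h]; exists n, e.
Qed.

Lemma nbhs_ptws_pair_coord {R : realType} (y : {ptws nat -> R} * {ptws nat -> R})
    (U : set ({ptws nat -> R} * {ptws nat -> R})) :
  nbhs y U -> exists n, exists2 e : R, 0 < e &
  forall y', (forall i, (i < n)%N -> `|y'.1 i - y.1 i| < e /\ `|y'.2 i - y.2 i| < e) -> U y'.
Proof.
move=> [[U1 U2] /= [/nbhs_ptws_coord[n1 [e1 e10 h1]] /nbhs_ptws_coord[n2 [e2 e20 h2]]] U12].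
exists (maxn n1 n2), (Num.min e1 e2); first by rewrite lt_min e10.
move=> [y1 y2] /= h; apply: U12; split => /=.
  by apply: h1 => i i_n; have [] := h i; rewrite ?leq_max ?i_n// lt_min => /andP[].
by apply: h2 => i i_n; have [] := h i; rewrite ?leq_max ?i_n ?orbT// !lt_min => _ /andP[].
Qed.

Lemma measurable_fun_nat {R : realType} {d} {X : measurableType d} (u : X -> nat) (h : nat -> R) :
  (forall n, measurable (u @^-1` [set n])) -> measurable_fun setT (fun x => h (u x)).
Proof.
move=> mu_ _ B mB; rewrite setTI.
rewrite (_ : _ @^-1` _ = \bigcup_(n in [set n | B (h n)]) (u @^-1` [set n])).
  by apply: bigcup_measurable => n _.
by apply/seteqP; split => x /=; [exists (u x)|move=> [n Bn ux]; rewrite ux].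
Qed.

(** * Entrance times and local observables *)

Section ReturnMeasurability.
Context {d} {X : measurableType d} (T : X -> X) (mT : measurable_fun setT T).
Context (A : set X) (mA : measurable A).

Lemma retime_eqS n : retime T A @^-1` [set n.+1] =
  iter n.+1 T @^-1` A `&` \bigcap_(i in [set i | (0 < i < n.+1)%N]) iter i T @^-1` (~` A).
Proof.
apply/seteqP; split => x /=; rewrite /retime.
  case: xgetP => [k kP [[k1 Ak] kmin] kn|]//; rewrite kn in k1 Ak kmin; split => // i /= /andP[i0 ik] Ai.
  by have := kmin i (conj i0 Ai); rewrite leqNgt ik.
move=> [An hA]; apply: xget_unique.
  split => // k [k0 Ak]; rewrite leqNgt; apply/negP => kn; apply: (hA k) => //=.
  by rewrite k0.
move=> k [[k0 Ak] kmin]; have kn := kmin n.+1 (conj isT An).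
apply/eqP; rewrite eqn_leq kn leqNgt; apply/negP => kn'; apply: (hA k) => //=.
by rewrite k0.
Qed.

Lemma measurable_retime n : measurable (retime T A @^-1` [set n]).
Proof.
have mS k : measurable (retime T A @^-1` [set k.+1]).
  rewrite retime_eqS; apply: measurableI; first exact: measurable_iter.
  by apply: bigcap_measurableType => i _; apply: measurable_iter => //; exact: measurableC.
(* The value 0 only marks orbits that never enter [A], so its level set is the complement of all the
   others. *)
case: n => [|n]; last exact: mS.
rewrite (_ : _ @^-1` _ = ~` \bigcup_k (retime T A @^-1` [set k.+1])).
  by apply: measurableC; exact: bigcup_measurable.
apply/seteqP; split => x /=; first by move=> x0 [k _ /=]; rewrite x0.
move=> h; case e : (retime T A x) => [//|k]; exfalso; apply: h; by exists k.
Qed.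

Lemma measurable_induced k B : measurable B -> measurable (iter k (Defs.induced T A) @^-1` B).
Proof.
elim: k B => //= k IH B mB.
rewrite [X in measurable X](_ : _ = iter k (Defs.induced T A) @^-1` (Defs.induced T A @^-1` B))//.
apply: IH; rewrite (_ : _ @^-1` _ = \bigcup_n (retime T A @^-1` [set n] `&` iter n T @^-1` B)).
  apply: bigcup_measurable => n _; apply: measurableI; first exact: measurable_retime.
  exact: measurable_iter.
apply/seteqP; split => x /=; first by move=> Bx; exists (retime T A x).
by move=> [n _ [/= nx Bx]]; rewrite /Defs.induced nx.
Qed.

End ReturnMeasurability.

(** * Lower bounds on boxes for both initial measures *)

Section BoxLiminf.
Context {R : realType} {d} {X : measurableType d} (dX : X -> X -> R).
Context (mu : probability X R) (T : X -> X) (xi : set (set X)).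
Context (GM : GibbsMarkov dX mu T xi) (ergT : ergodic mu T).
Context (A : nat -> set X) (mA : forall l, measurable (A l)).
Context (Apos : forall l, 0 < pr mu (A l)).
Context (A0 : (fun l => pr mu (A l)) @ \oo --> (0 : R)).
Context (xiA : forall l, xi_measurable mu xi (A l)).
Context (psi : nat -> X -> nat) (mpsi : forall l j, measurable (psi l @^-1` [set j])).

Definition obs_cell l (b b' : R) : set X := A l `&` [set x | b < (psi l x)%:R <= b'].

Context (th : R -> R -> R).
Context (xi_cell : forall l b b', xi_measurable mu xi (obs_cell l b b')).
Context (cell_limit : forall b b',
  (fun l => pr mu (obs_cell l b b') / pr mu (A l)) @ \oo --> th b b').

Let mT : measurable_fun setT T := GM_measurable _ _ _ _ GM.

Lemma measurable_scaled_Phi l i :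
  measurable_fun setT (fun x => scaled_Phi T (A l) (pr mu (A l)) x i).
Proof.
apply: (measurable_fun_nat (fun x => retime T (A l) (iter i (Defs.induced T (A l)) x))
  (fun n => pr mu (A l) * n%:R)) => n.
rewrite [X in measurable X](_ : _ = iter i (Defs.induced T (A l)) @^-1` (retime T (A l) @^-1` [set n]))//.
by apply: measurable_induced => //; exact: measurable_retime.
Qed.

Lemma measurable_Psi_tilde l i :
  measurable_fun setT (fun x => Psi_tilde T (A l) (psi l) x i : R).
Proof.
apply: (measurable_fun_nat (fun x => psi l (iter i (Defs.induced T (A l)) x))
  (fun n => n%:R)) => n.
rewrite [X in measurable X](_ : _ = iter i (Defs.induced T (A l)) @^-1` (psi l @^-1` [set n]))//.
exact: measurable_induced.
Qed.

Lemma measurable_Psi_seq l i :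
  measurable_fun setT (fun x => Psi_seq T (A l) (psi l) x i : R).
Proof. exact: (measurable_Psi_tilde l i.+1). Qed.

Lemma measurable_obs_cell l b b' : measurable (obs_cell l b b').
Proof.
apply: measurableI => //.
rewrite (_ : [set x | _] = \bigcup_(j in [set j : nat | b < j%:R <= b']) (psi l @^-1` [set j])).
  by apply: bigcup_measurable => j _.
by apply/seteqP; split => x /=; [exists (psi l x)|move=> [j + /= jx]; rewrite jx].
Qed.

Let obs_cellA l b b' : obs_cell l b b' `<=` A l.
Proof. by move=> x []. Qed.

Context (a a' b b' : nat -> R) (aa' : forall i, a i <= a' i).

Definition limit_prob n : R := \prod_(i < n) ((exp_tail (a i) - exp_tail (a' i)) * th (b i) (b' i)).

Lemma box_liminf_stationary n (V : nat -> set X) : (forall l, measurable (V l)) ->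
  (forall l x, (forall i, (i < n)%N ->
    a i < scaled_Phi T (A l) (pr mu (A l)) x i <= a' i /\
    b i < (Psi_seq T (A l) (psi l) x i : R) <= b' i) -> V l x) ->
  forall e, 0 < e -> \forall l \near \oo, limit_prob n - e <= pr mu (V l).
Proof.
move=> mV hV e e0.
have := scaled_box_limit _ _ _ _ GM ergT A mA Apos A0 xiA a a'
  (fun l i => obs_cell l (b i) (b' i)) (fun i => th (b i) (b' i)) aa'
  (fun l i => measurable_obs_cell l _ _) (fun l i => obs_cellA l _ _)
  (fun l i => xi_cell l _ _) (fun i => cell_limit _ _) n 0.
move=> [/cvgrPdist_le/(_ _ e0) + _]; apply: filterS => l; rewrite ler_norml => /andP[_].
rewrite /box_limit; under eq_bigr do rewrite add0n.
rewrite -/(limit_prob n) lerBlDr -lerBlDl => /le_trans; apply.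
apply: pr_le => //.
  by apply: (measurable_scaled_box _ _ _ _ GM A mA) => l' i'; exact: measurable_obs_cell.
move=> x /(scaled_box_sub mu T A Apos) hx; apply: hV => i i_n.
by have [|h1 [_ h2]] := hx _ i i_n; first by move=> l' i'; exact: obs_cellA.
Qed.

(** [Psi_tilde] reads its first value at the starting point, so observation 0 restricts the initial
    set and observation [i + 1] restricts the [i]-th target [D l i]. The last target carries no
    observation: it is [A l], with share 1. *)
Lemma box_liminf_conditional n (V : nat -> set X) : (forall l, measurable (V l)) ->
  (forall l x, (forall i, (i < n)%N ->
    a i < scaled_Phi T (A l) (pr mu (A l)) x i <= a' i /\
    b i < (Psi_tilde T (A l) (psi l) x i : R) <= b' i) -> V l x) ->
  forall e, 0 < e -> \forall l \near \oo,
    limit_prob n - e <= pr mu (A l `&` V l) / pr mu (A l).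
Proof.
case: n => [|k] mV hV e e0.
  apply: nearW => l; rewrite /limit_prob big_ord0 (_ : A l `&` V l = A l).
    by rewrite divff ?gt_eqF//; lra.
  by apply: setIidl => x _; exact: hV.
pose D l i := if (i < k)%N then obs_cell l (b i.+1) (b' i.+1) else A l.
pose th' i := if (i < k)%N then th (b i.+1) (b' i.+1) else 1.
have mD l i : measurable (D l i).
  by rewrite /D; case: ifP => _ //; exact: measurable_obs_cell.
have DA l i : D l i `<=` A l by rewrite /D; case: ifP => _ //; exact: obs_cellA.
have xiD l i : xi_measurable mu xi (D l i) by rewrite /D; case: ifP.
have Dth i : (fun l => pr mu (D l i) / pr mu (A l)) @ \oo --> th' i.
  rewrite /D /th'; case: ifP => _; first exact: cell_limit.
  rewrite (_ : (fun l => _) = fun=> 1); first exact: cvg_cst.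
  by apply/funext => l; rewrite divff// gt_eqF.
have [_] := scaled_box_limit _ _ _ _ GM ergT A mA Apos A0 xiA a a' D th' aa' mD DA xiD Dth k.+1 0.
set L := box_limit _ _ _ _ _.
have e2 : 0 < e / 2 by rewrite divr_gt0.
move=> /(_ (fun l => obs_cell l (b 0%N) (b' 0%N)) (fun l => measurable_obs_cell l _ _) (fun l => xi_cell l _ _) _ e2) h1.
have LE : th (b 0%N) (b' 0%N) * L = limit_prob k.+1.
  rewrite /L /box_limit /limit_prob; under eq_bigr do rewrite add0n.
  rewrite !big_split/= mulrCA; congr (_ * _).
  rewrite big_ord_recr/= /th' ltnn mulr1 [RHS]big_ord_recl; congr (_ * _).
  by apply: eq_bigr => i _; rewrite ltn_ord lift0.
have h2 : (fun l => pr mu (obs_cell l (b 0%N) (b' 0%N)) / pr mu (A l) * L) @ \oo --> limit_prob k.+1.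
  by rewrite -LE; apply: cvgM; [exact: cell_limit|exact: cvg_cst].
move/cvgrPdist_le : h2 => /(_ _ e2) h2.
apply: filterS2 h1 h2 => l h1 h2.
set B := obs_cell l (b 0%N) (b' 0%N) in h1 h2.
set box := scaled_box _ _ _ _ _ _ _ _ _ in h1.
have mB : measurable B by exact: measurable_obs_cell.
have mbox : measurable box by exact: (measurable_scaled_box _ _ _ _ GM A mA).
have c0 := Apos l.
have BA : pr mu B <= pr mu (A l) by apply: pr_le => //; exact: obs_cellA.
have h3 : pr mu (B `&` box) <= pr mu (A l `&` V l).
  apply: pr_le; [exact: measurableI|exact: measurableI|].
  move=> x [[Ax Bx] bx]; split => //; apply: hV => i ik.
  have hx := scaled_box_sub mu T A Apos a a' D DA l k.+1 x bx.
  have [h _] := hx i ik; split => //.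
  case: i ik {h} => [//|i] ik; have [_] := hx i (ltnW ik).
  by rewrite /D (_ : (i < k)%N)// => -[].
have : pr mu (B `&` box) / pr mu (A l) <= pr mu (A l `&` V l) / pr mu (A l).
  by rewrite ler_pM2r ?invr_gt0.
have : pr mu B / pr mu (A l) * L - e / 2 <= pr mu (B `&` box) / pr mu (A l).
  rewrite ler_pdivlMr// mulrBl mulrAC divfK ?gt_eqF//.
  have : e / 2 * pr mu B <= e / 2 * pr mu (A l) by rewrite ler_pM2l.
  by move: h1; rewrite ler_norml => /andP[h1 _]; lra.
by move: h2; rewrite ler_norml => /andP[_ h2]; lra.
Qed.

End BoxLiminf.

Lemma std_exponential_itv {R : realType} {d} {O : measurableType d} (P : probability O R)
    (Y : O -> R) (a a' : R) : measurable_fun setT Y -> std_exponential P Y -> a <= a' ->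
  pr P (Y @^-1` `]a, a']) = exp_tail a - exp_tail a'.
Proof.
move=> mY expY aa'.
have mle t : measurable (Y @^-1` `]-oo, t]).
  by rewrite -[X in measurable X]setTI; apply: mY => //; exact: measurable_itv.
have pY t : pr P (Y @^-1` `]-oo, t]) = 1 - exp_tail t.
  rewrite /pr expY /exp_tail; case: ltP => t0 //=.
  by rewrite oppr0 expR0 subrr.
have := pr_split P _ _ (mle a') (mle a); rewrite !pY.
have -> : Y @^-1` `]-oo, a'] `&` Y @^-1` `]-oo, a] = Y @^-1` `]-oo, a].
  apply: setIidr => x /=; rewrite !in_itv/= => h; exact: le_trans aa'.
have -> : Y @^-1` `]-oo, a'] `\` Y @^-1` `]-oo, a] = Y @^-1` `]a, a'].
  apply/seteqP; split => x /=; rewrite !in_itv/=.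
    by move=> [-> /negP]; rewrite -ltNge => ->.
  by move=> /andP[h ->]; split => //; apply/negP; rewrite -ltNge.
rewrite pY; lra.
Qed.

Lemma mutually_independent_pr {R : realType} {d} {O : measurableType d} (P : probability O R)
    {I : eqType} (Y : I -> O -> R) (J : seq I) (B : I -> set R) :
  mutually_independent P Y -> uniq J -> (forall i, measurable (B i)) ->
  pr P (\bigcap_(i in [set i | i \in J]) (Y i @^-1` B i)) = \prod_(i <- J) pr P (Y i @^-1` B i).
Proof.
move=> [mY indY] uJ mB; rewrite /pr indY//.
rewrite (eq_bigr (fun i => (pr P (Y i @^-1` B i))%:E)); first by rewrite prodEFin.
by move=> i _; rewrite prE// -[X in measurable X]setTI; exact: mY.
Qed.

(** * Joint convergence of return times and observations *)

Section JointConvergence.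
Context {R : realType} {d} {X : measurableType d} (dX : X -> X -> R).
Context (mu : probability X R) (T : X -> X) (xi : set (set X)).
Context (GM : GibbsMarkov dX mu T xi) (ergT : ergodic mu T).
Context (A : nat -> set X) (mA : forall l, measurable (A l)).
Context (Apos : forall l, 0 < pr mu (A l)).
Context (A0 : (fun l => pr mu (A l)) @ \oo --> (0 : R)).
Context (xiA : forall l, xi_measurable mu xi (A l)).

(** The limiting share [th] and the limit law are left abstract, so that a constant observable gives
    (a) and the partition gives (b). *)
Lemma joint_wconv (psi : nat -> X -> nat) (th : R -> R -> R)
    {dO} {O : measurableType dO} (P : probability O R) (E Psi : nat -> O -> R) :
  (forall l j, measurable (psi l @^-1` [set j])) ->
  (forall l (b b' : R), xi_measurable mu xi (obs_cell A psi l b b')) ->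
  (forall b b' : R, (fun l => pr mu (obs_cell A psi l b b') / pr mu (A l)) @ \oo --> th b b') ->
  (forall i, measurable_fun setT (E i)) -> (forall i, measurable_fun setT (Psi i)) ->
  (forall n a a' b b', (forall i, a i <= a' i) -> (forall i, b i <= b' i) ->
    pr P [set w | forall i, (i < n)%N -> a i < E i w <= a' i /\ b i < Psi i w <= b' i] =
    limit_prob th a a' b b' n) ->
  wconv mu A
    (fun l x => ((scaled_Phi T (A l) (fine (mu (A l))) x : {ptws nat -> R}),
                 (Psi_tilde T (A l) (psi l) x : {ptws nat -> R})))
    P (fun w => ((fun i => E i w) : {ptws nat -> R}, (fun i => Psi i w) : {ptws nat -> R})) /\
  wconv mu (fun _ => setT)
    (fun l x => ((scaled_Phi T (A l) (fine (mu (A l))) x : {ptws nat -> R}),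
                 (Psi_seq T (A l) (psi l) x : {ptws nat -> R})))
    P (fun w => ((fun i => E i w) : {ptws nat -> R}, (fun i => Psi i w) : {ptws nat -> R})).
Proof.
move=> mpsi xi_cell cell_lim mE mPsi hP.
pose p i (y : {ptws nat -> R} * {ptws nat -> R}) := y.1 i.
pose q i (y : {ptws nat -> R} * {ptws nat -> R}) := y.2 i.
have mPhi := measurable_scaled_Phi _ mu _ _ GM A mA.
have mtil := measurable_Psi_tilde _ mu _ _ GM A mA psi mpsi.
have mseq := measurable_Psi_seq _ mu _ _ GM A mA psi mpsi.
split.
  apply: (@wconv_of_boxes _ _ p q nbhs_ptws_pair_coord) => //.
  move=> n a a' b b' aa' bb' e e0.
  rewrite [pr P _](hP n a a' b b' aa' bb').
  apply: (box_liminf_conditional _ _ _ _ GM ergT A mA Apos A0 xiA psi mpsi) => //.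
  by move=> l; apply: measurable_coord_box; [exact: mPhi|exact: mtil].
apply: (@wconv_of_boxes _ _ p q nbhs_ptws_pair_coord) => //.
  by move=> _; rewrite pr_setT.
move=> n a a' b b' aa' bb' e e0.
rewrite [pr P _](hP n a a' b b' aa' bb') pr_setT.
have : \forall l \near \oo, limit_prob th a a' b b' n - e <= pr mu
    [set x | forall i, (i < n)%N -> a i < scaled_Phi T (A l) (pr mu (A l)) x i <= a' i /\
      b i < (Psi_seq T (A l) (psi l) x i : R) <= b' i].
  apply: (box_liminf_stationary _ _ _ _ GM ergT A mA Apos A0 xiA psi mpsi) => //.
  move=> l; pose Y x := ((scaled_Phi T (A l) (pr mu (A l)) x : {ptws nat -> R}),
                 (Psi_seq T (A l) (psi l) x : {ptws nat -> R})).
  rewrite [X in measurable X](_ : _ = Y @^-1` coord_box p q n a a' b b')//.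
  by apply: measurable_coord_box; [exact: mPhi|exact: mseq].
by apply: filterS => l; rewrite setTI divr1.
Qed.

Lemma xi_measurable0 : xi_measurable mu xi set0.
Proof. by exists set0 => //; rewrite bigcup_set0 setD0 setU0 measure0. Qed.

Lemma xi_measurableU B C : measurable B -> measurable C ->
  xi_measurable mu xi B -> xi_measurable mu xi C -> xi_measurable mu xi (B `|` C).
Proof.
move=> mB mC [S Sxi S0] [S' Sxi' S0']; exists (S `|` S'); first by move=> Z [/Sxi|/Sxi'].
have mU (Q : set (set X)) : Q `<=` xi -> measurable (\bigcup_(Z in Q) Z).
  move=> Qxi; have [F [_ _ mF <-]] := cells_enum _ _ _ _ GM Q Qxi.
  exact: bigcup_measurable.
have mS := mU _ Sxi; have mS' := mU _ Sxi'.
have mSS : measurable (\bigcup_(Z in S `|` S') Z) by rewrite bigcup_setU; exact: measurableU.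
have mDD (B1 B2 : set X) : measurable B1 -> measurable B2 -> measurable ((B1 `\` B2) `|` (B2 `\` B1)).
  by move=> ? ?; apply: measurableU; exact: measurableD.
have mDU := measurableU _ _ (mDD _ _ mB mS) (mDD _ _ mC mS').
have mBC := mDD _ _ (measurableU _ _ mB mC) mSS.
apply: (subset_measure0 mBC mDU); last by apply: null_set_setU => //; exact: mDD.
rewrite bigcup_setU => x /=; move: (\bigcup_(Z in S) Z) (\bigcup_(Z in S') Z) => U U'.
by have [] := pselect (U x); have [] := pselect (U' x); have [] := pselect (B x); have [] := pselect (C x); tauto.
Qed.

Lemma xi_measurable_bigsetU (r : seq nat) (C : nat -> set X) :
  (forall j, measurable (C j)) -> (forall j, xi_measurable mu xi (C j)) ->
  xi_measurable mu xi (\big[setU/set0]_(j <- r) C j).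
Proof.
move=> mC xiC; elim: r => [|j r IH]; first by rewrite big_nil; exact: xi_measurable0.
by rewrite big_cons; apply: xi_measurableU => //; exact: bigsetU_measurable.
Qed.

End JointConvergence.

Lemma cvg_sum_seq {R : realType} (r : seq nat) (f : nat -> nat -> R) (a : nat -> R) :
  (forall j, f j @ \oo --> a j) ->
  (fun l => \sum_(j <- r) f j l) @ \oo --> \sum_(j <- r) a j.
Proof.
move=> fa; elim: r => [|j r IH].
  by rewrite big_nil (_ : (fun l => _) = fun=> 0); [exact: cvg_cst|apply/funext => l; rewrite big_nil].
rewrite big_cons (_ : (fun l => _) = f j \+ (fun l => \sum_(j <- r) f j l)).
  by apply: cvgD.
by apply/funext => l; rewrite big_cons.
Qed.

Section LocalObservable.
Context {X : Type} (m : nat) (Apart : nat -> set X).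
Context (disj : forall j k, (1 <= j <= m)%N -> (1 <= k <= m)%N -> j <> k ->
  Apart j `&` Apart k = set0).

(** Empty cells outside [1..m] make the family disjoint over all natural indices, as the lemmas on
    finite unions require. *)
Definition part_cell j : set X := if (1 <= j <= m)%N then Apart j else set0.

Lemma part_cell_disjoint i j : i <> j -> part_cell i `&` part_cell j = set0.
Proof.
rewrite /part_cell; case: ifP => im; case: ifP => jm ij; rewrite ?set0I ?setI0//.
exact: disj.
Qed.

Lemma loc_obs_cell j x : part_cell j x -> loc_obs m Apart x = j.
Proof.
rewrite /part_cell; case: ifP => // jm Ax; apply: xget_unique => // k [km Ak].
apply: contrapT => kj; have : (Apart k `&` Apart j) x by [].
by rewrite disj.
Qed.

Lemma loc_obsS j : loc_obs m Apart @^-1` [set j.+1] = part_cell j.+1.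
Proof.
apply/seteqP; split => x /=; last exact: loc_obs_cell.
rewrite /loc_obs; case: xgetP => [k _ [km Ak] kj|//].
by rewrite kj in km Ak; rewrite /part_cell km.
Qed.

End LocalObservable.

Lemma measurable_loc_obs {d} {X : measurableType d} m (Apart : nat -> set X) :
  (forall j, measurable (Apart j)) ->
  (forall j k, (1 <= j <= m)%N -> (1 <= k <= m)%N -> j <> k -> Apart j `&` Apart k = set0) ->
  forall j, measurable (loc_obs m Apart @^-1` [set j]).
Proof.
move=> mA disj.
have mS j : measurable (loc_obs m Apart @^-1` [set j.+1]).
  by rewrite loc_obsS// /part_cell; case: ifP.
case=> [|//].
rewrite (_ : _ @^-1` _ = ~` \bigcup_k (loc_obs m Apart @^-1` [set k.+1])).
  by apply: measurableC; exact: bigcup_measurable.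
apply/seteqP; split => x /=; first by move=> x0 [k _ /=]; rewrite x0.
by move=> h; case e : (loc_obs m Apart x) => [//|k]; exfalso; apply: h; exists k.
Qed.

Lemma wconv_fst {R : realType} {d} {X : measurableType d} {dO} {O : measurableType dO}
    {S S' : topologicalType} (mu : probability X R) (A : nat -> set X)
    (Y : nat -> X -> S) (Y' : nat -> X -> S') (P : probability O R) (Z : O -> S) (Z' : O -> S') :
  wconv mu A (fun l x => (Y l x, Y' l x)) P (fun w => (Z w, Z' w)) -> wconv mu A Y P Z.
Proof.
move=> h g [gc [M gM]]; apply: (h (fun s => g s.1)); split; last by exists M.
by move=> s; apply: continuous_comp; [exact: cvg_fst|exact: gc].
Qed.

(** * Poisson asymptotics without and with local observables *)

Section Conclusion.
Context {R : realType} {d} {X : measurableType d} (dX : X -> X -> R).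
Context (mu : probability X R) (T : X -> X) (xi : set (set X)).
Context (GM : GibbsMarkov dX mu T xi) (ergT : ergodic mu T).
Context (A : nat -> set X) (mA : forall l, measurable (A l)).
Context (Apos : forall l, 0 < pr mu (A l)).
Context (A0 : (fun l => pr mu (A l)) @ \oo --> (0 : R)).
Context (xiA : forall l, xi_measurable mu xi (A l)).

Lemma Poisson_asymptotics {dO} {O : measurableType dO} (P : probability O R)
    (E : nat -> O -> R) :
  mutually_independent P E -> (forall i, std_exponential P (E i)) ->
  wconv mu (fun _ => setT)
    (fun l x => (scaled_Phi T (A l) (fine (mu (A l))) x : {ptws nat -> R}))
    P (fun w => (fun i => E i w) : {ptws nat -> R}) /\
  wconv mu A
    (fun l x => (scaled_Phi T (A l) (fine (mu (A l))) x : {ptws nat -> R}))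
    P (fun w => (fun i => E i w) : {ptws nat -> R}).
Proof.
move=> indE expE; have [mE _] := indE.
(* The observable is constantly 0, so an interval of values has share 1 or 0 according to whether it
   contains 0; the return times are then obtained by projection. *)
pose th (b b' : R) : R := if b < 0 <= b' then 1 else 0.
have cellE l (b b' : R) : obs_cell A (fun _ _ => 0%N) l b b' = if b < 0 <= b' then A l else set0.
  by rewrite /obs_cell; case: ifP => _; apply/seteqP; split => x // -[].
have := joint_wconv _ _ _ _ GM ergT A mA Apos A0 xiA (fun _ _ => 0%N) th P E (fun _ _ => 0).
case.
- move=> l j; case: j => [|j].
    by rewrite (_ : _ @^-1` _ = setT)//; apply/seteqP; split.
  by rewrite (_ : _ @^-1` _ = set0)//; apply/seteqP; split.
- by move=> l b b'; rewrite cellE; case: ifP => // _; exact: xi_measurable0.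
- move=> b b'; rewrite (_ : (fun l => _) = fun=> th b b'); first exact: cvg_cst.
  apply/funext => l; rewrite cellE /th; case: ifP => _; last by rewrite pr_set0 mul0r.
  by rewrite divff// gt_eqF.
- exact: mE.
- by move=> i; exact: measurable_cst.
- move=> n a a' b b' aa' bb'; rewrite /limit_prob.
  have [ok|nok] := pselect (forall i : 'I_n, b i < 0 <= b' i); last first.
    have [i hi] : exists i : 'I_n, ~ (b i < 0 <= b' i) by apply/existsNP.
    have th0 : th (b i) (b' i) = 0 by rewrite /th ifF//; exact/negP.
    rewrite (bigD1 i)//= th0 mulr0 mul0r (_ : [set w | _] = set0) ?pr_set0//.
    by apply/seteqP; split => // w /= /(_ i (ltn_ord i))[].
  rewrite (eq_bigr (fun i : 'I_n => pr P (E i @^-1` `]a i, a' i]))); last first.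
    by move=> i _; rewrite /th ok mulr1 std_exponential_itv.
  rewrite -(big_mkord xpredT (fun i => pr P (E i @^-1` `]a i, a' i]))).
  rewrite -(mutually_independent_pr _ _ _ (fun i => [set` `]a i, a' i]]) indE (iota_uniq _ _)).
    congr (pr P _); apply/seteqP; split => w /= h i.
      by rewrite /= mem_index_iota => i_n; rewrite /= in_itv/=; have [] := h i i_n.
    move=> i_n; have := h i; rewrite /= mem_index_iota in_itv/= => /(_ i_n) ->.
    by split => //; exact: (ok (Ordinal i_n)).
  by move=> i; exact: measurable_itv.
move=> h1 h2; split; [exact: wconv_fst h2|exact: wconv_fst h1].
Qed.

Lemma Poisson_asymptotics_local (m : nat) (Apart : nat -> nat -> set X) (theta : nat -> R) :
  (forall l j, measurable (Apart l j)) ->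
  (forall l j, (1 <= j <= m)%N -> xi_measurable mu xi (Apart l j)) ->
  (forall l, A l = \bigcup_(j in [set j | (1 <= j <= m)%N]) Apart l j) ->
  (forall l j k, (1 <= j <= m)%N -> (1 <= k <= m)%N -> j <> k ->
     Apart l j `&` Apart l k = set0) ->
  (forall j, (1 <= j <= m)%N ->
     (fun l => pr mu (Apart l j) / pr mu (A l)) @ \oo --> theta j) ->
  forall {dO} {O : measurableType dO} (P : probability O R) (E Psi : nat -> O -> R),
    mutually_independent P
      (fun i : nat + nat => match i with inl k => E k | inr k => Psi k end) ->
    (forall i, std_exponential P (E i)) ->
    (forall i j, (1 <= j <= m)%N -> P (Psi i @^-1` [set (j%:R : R)]) = (theta j)%:E) ->
    wconv mu A
      (fun l x => ((scaled_Phi T (A l) (fine (mu (A l))) x : {ptws nat -> R}),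
                   (Psi_tilde T (A l) (loc_obs m (Apart l)) x : {ptws nat -> R})))
      P (fun w => ((fun i => E i w) : {ptws nat -> R}, (fun i => Psi i w) : {ptws nat -> R})) /\
    wconv mu (fun _ => setT)
      (fun l x => ((scaled_Phi T (A l) (fine (mu (A l))) x : {ptws nat -> R}),
                   (Psi_seq T (A l) (loc_obs m (Apart l)) x : {ptws nat -> R})))
      P (fun w => ((fun i => E i w) : {ptws nat -> R}, (fun i => Psi i w) : {ptws nat -> R})).
Proof.
move=> mAp xiAp AE disj Alim dO O P E Psi ind expE PPsi.
pose theta' j := if (1 <= j <= m)%N then theta j else 0.
pose sel (b b' : R) := [seq j <- iota 1 m | b < j%:R <= b'].
pose th (b b' : R) := \sum_(j <- sel b b') theta' j.
pose Ap l j := part_cell m (Apart l) j.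
have mAp' l j : measurable (Ap l j) by rewrite /Ap /part_cell; case: ifP.
have dAp l i j : i <> j -> Ap l i `&` Ap l j = set0 by apply: part_cell_disjoint; exact: disj.
have usel b b' : uniq (sel b b') by apply: filter_uniq; exact: iota_uniq.
have cellE l b b' : obs_cell A (fun l => loc_obs m (Apart l)) l b b' =
    \big[setU/set0]_(j <- sel b b') Ap l j.
  rewrite -bigcup_seq /obs_cell AE; apply/seteqP; split => x /=.
    move=> [[j jm Ax]]; have Aj : Ap l j x by rewrite /Ap /part_cell jm.
    rewrite (loc_obs_cell _ _ (disj l) _ _ Aj) => jb; exists j => //=.
    by rewrite mem_filter jb mem_iota; move: jm => /=; lia.
  move=> [j /=]; rewrite mem_filter mem_iota => /andP[jb jm] Aj.
  rewrite (loc_obs_cell _ _ (disj l) _ _ Aj); split => //; exists j => /=; first by lia.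
  by move: Aj; rewrite /Ap /part_cell; case: ifP.
have Aplim j : (fun l => pr mu (Ap l j) / pr mu (A l)) @ \oo --> theta' j.
  rewrite /Ap /part_cell /theta'; case: ifP => jm; first exact: Alim.
  rewrite (_ : (fun l => _) = fun=> 0); first exact: cvg_cst.
  by apply/funext => l; rewrite pr_set0 mul0r.
have cell_lim b b' : (fun l => pr mu (obs_cell A (fun l => loc_obs m (Apart l)) l b b') / pr mu (A l)) @ \oo --> th b b'.
  rewrite (_ : (fun l => _) = (fun l => \sum_(j <- sel b b') (pr mu (Ap l j) / pr mu (A l)))).
    exact: cvg_sum_seq.
  by apply/funext => l; rewrite cellE (pr_bigsetU_sum mu _ _ _ (mAp' l) (dAp l) (usel b b')) mulr_suml.
have sel_all : sel 0 m%:R = iota 1 m.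
  apply/all_filterP/allP => j; rewrite mem_iota ltr0n ler_nat; lia.
(* The cells exhaust each [A l], so their limiting shares sum to 1. This is what confines [Psi i] to
   [1..m] almost surely, and so determines its law on intervals. *)
have theta1 : \sum_(j <- iota 1 m) theta' j = 1.
  have := cell_lim 0 m%:R; rewrite /th sel_all.
  rewrite (_ : (fun l => _) = fun=> 1); last first.
    apply/funext => l; rewrite (_ : obs_cell _ _ _ _ _ = A l) ?divff ?gt_eqF//.
    rewrite cellE sel_all -bigcup_seq AE; apply/seteqP; split => x.
      move=> [j /=]; rewrite mem_iota => jm; rewrite /Ap /part_cell; case: ifP => // jm' Ax.
      by exists j.
    by move=> [j /= jm Ax]; exists j => /=; [rewrite mem_iota; lia|rewrite /Ap /part_cell jm].
  move=> h; apply/eqP; rewrite eq_le; apply/andP; split.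
    exact: (le_cvg_seq _ _ _ _ h (@cvg_cst _ (1 : R) _ \oo _)).
  exact: (le_cvg_seq _ _ _ _ (@cvg_cst _ (1 : R) _ \oo _) h).
have mE i : measurable_fun setT (E i) by exact: (ind.1 (inl i)).
have mPsi i : measurable_fun setT (Psi i) by exact: (ind.1 (inr i)).
have PPsi_itv i b b' : pr P (Psi i @^-1` `]b, b']) = th b b'.
  pose C j := if (1 <= j <= m)%N then Psi i @^-1` [set (j%:R : R)] else set0.
  have mC j : measurable (C j).
    rewrite /C; case: ifP => // _; rewrite -[X in measurable X]setTI.
    by apply: mPsi => //; exact: measurable_set1.
  have dC j k : j <> k -> C j `&` C k = set0.
    move=> jk; rewrite /C; case: ifP => _; case: ifP => _; rewrite ?set0I ?setI0//.
    apply/seteqP; split => // w /= [-> /eqP]; rewrite eqr_nat => /eqP; exact: jk.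
  have pC j : pr P (C j) = theta' j.
    rewrite /C /theta'; case: ifP => jm; last exact: pr_set0.
    by rewrite /pr PPsi.
  have mU r : measurable (\big[setU/set0]_(j <- r) C j) by exact: bigsetU_measurable.
  have mQ : measurable (Psi i @^-1` `]b, b']).
    by rewrite -[X in measurable X]setTI; apply: mPsi => //; exact: measurable_itv.
  rewrite (pr_split P _ _ mQ (mU (iota 1 m))).
  have -> : pr P (Psi i @^-1` `]b, b'] `\` \big[setU/set0]_(j <- iota 1 m) C j) = 0.
    apply/eqP; rewrite eq_le pr_ge0 andbT.
    apply: (@le_trans _ _ (pr P (~` \big[setU/set0]_(j <- iota 1 m) C j))).
      apply: pr_le; [exact: measurableD|exact: measurableC|by move=> w []].
    rewrite pr_setC// (pr_bigsetU_sum P _ _ _ mC dC (iota_uniq _ _)).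
    by rewrite (eq_bigr theta') ?theta1 ?subrr// => j _; exact: pC.
  rewrite addr0 (_ : _ `&` _ = \big[setU/set0]_(j <- sel b b') C j).
    by rewrite (pr_bigsetU_sum P _ _ _ mC dC (usel b b')); apply: eq_bigr => j _; exact: pC.
  rewrite -!bigcup_seq; apply/seteqP; split => w /=.
    rewrite in_itv/= => -[wb [j /= jm Cj]]; exists j => //=.
    rewrite mem_filter jm andbT; move: Cj wb; rewrite /C; case: ifP => //= _ -> //.
  move=> [j /=]; rewrite mem_filter => /andP[jb jm] Cj; split; last by exists j.
  by move: Cj jb; rewrite /C; case: ifP => //= _ -> ?; rewrite in_itv.
apply: (joint_wconv _ _ _ _ GM ergT A mA Apos A0 xiA (fun l => loc_obs m (Apart l)) th) => //.
- by move=> l j; apply: measurable_loc_obs; [exact: mAp|exact: disj].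
- move=> l b b'; rewrite cellE; apply: (xi_measurable_bigsetU _ _ _ _ GM) => // j.
  by rewrite /Ap /part_cell; case: ifP => jm; [exact: xiAp|exact: xi_measurable0].
move=> n a a' b b' aa' bb'; rewrite /limit_prob.
pose B (k : nat + nat) : set R := match k with inl i => `]a i, a' i]%classic | inr i => `]b i, b' i]%classic end.
pose J : seq (nat + nat) := map inl (iota 0 n) ++ map inr (iota 0 n).
have mB k : measurable (B k) by case: k => i; exact: measurable_itv.
have uJ : uniq J.
  rewrite cat_uniq !map_inj_uniq ?iota_uniq ?andbT//=; try by move=> ? ? [].
  by apply/hasPn => _ /mapP[i _ ->]; apply/negP => /mapP[].
have := mutually_independent_pr _ _ J B ind uJ mB.
rewrite big_cat !big_map/=.
rewrite [X in X * _](eq_bigr (fun i => exp_tail (a i) - exp_tail (a' i))); last first.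
  by move=> i _; rewrite std_exponential_itv.
rewrite [X in _ * X](eq_bigr (fun i => th (b i) (b' i))); last by move=> i _; exact: PPsi_itv.
have -> : iota 0 n = index_iota 0 n by rewrite /index_iota subn0.
rewrite !big_mkord -big_split/= => <-; congr (pr P _).
apply/seteqP; split => w /= h.
  move=> [i|i] /=; rewrite /J mem_cat => /orP[] /mapP[k]; rewrite mem_iota add0n => kn // [->].
    by rewrite in_itv/=; have [] := h k kn.
  by rewrite in_itv/=; have [] := h k kn.
move=> i i_n; split.
  have := h (inl i); rewrite /= in_itv/=; apply; rewrite /J mem_cat map_f// mem_iota.
  by rewrite add0n.
have := h (inr i); rewrite /= in_itv/=; apply; rewrite /J mem_cat.
by rewrite (map_f inr) ?orbT// mem_iota add0n.
Qed.

End Conclusion.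
Theorem mainTheorem15 (R : realType) (d : measure_display) (X : measurableType d)
  (dX : X -> X -> R) (mu : probability X R) (T : X -> X) (xi : set (set X))
  (A : nat -> set X) :
  GibbsMarkov dX mu T xi -> ergodic mu T ->
  (forall l, measurable (A l)) ->
  (forall l, (0 < mu (A l))%E) ->
  (fun l => fine (mu (A l))) @ \oo --> (0 : R) ->
  (forall l, xi_measurable mu xi (A l)) ->
  (* (a) Poisson asymptotics *)
  (forall (dO : measure_display) (O : measurableType dO) (P : probability O R)
     (E : nat -> O -> R),
     mutually_independent P E -> (forall i, std_exponential P (E i)) ->
     wconv mu (fun _ => setT)
       (fun l x => (scaled_Phi T (A l) (fine (mu (A l))) x : {ptws nat -> R}))
       P (fun w => (fun i => E i w) : {ptws nat -> R})
     /\
     wconv mu A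
       (fun l x => (scaled_Phi T (A l) (fine (mu (A l))) x : {ptws nat -> R}))
       P (fun w => (fun i => E i w) : {ptws nat -> R}))
  /\
  (* (b) joint convergence with the local observables *)
  (forall (m : nat) (Apart : nat -> nat -> set X) (theta : nat -> R),
     (2 <= m)%N ->
     (forall l j, measurable (Apart l j)) ->
     (forall l j, (1 <= j <= m)%N -> xi_measurable mu xi (Apart l j)) ->
     (forall l, A l = \bigcup_(j in [set j | (1 <= j <= m)%N]) Apart l j) ->
     (forall l j k, (1 <= j <= m)%N -> (1 <= k <= m)%N -> j <> k ->
        Apart l j `&` Apart l k = set0) ->
     (forall j, (1 <= j <= m)%N ->
        (fun l => fine (mu (Apart l j)) / fine (mu (A l))) @ \oo --> theta j) ->
     (forall j, (1 <= j <= m)%N -> 0 < theta j < 1) ->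
     forall (dO : measure_display) (O : measurableType dO) (P : probability O R)
       (E : nat -> O -> R) (Psi : nat -> O -> R),
       mutually_independent P
         (fun i : nat + nat => match i with inl k => E k | inr k => Psi k end) ->
       (forall i, std_exponential P (E i)) ->
       (forall i j, (1 <= j <= m)%N ->
          P (Psi i @^-1` [set (j%:R : R)]) = (theta j)%:E) ->
       wconv mu A
         (fun l x => ((scaled_Phi T (A l) (fine (mu (A l))) x : {ptws nat -> R}),
                      (Psi_tilde T (A l) (loc_obs m (Apart l)) x : {ptws nat -> R})))
         P (fun w => ((fun i => E i w) : {ptws nat -> R},
                      (fun i => Psi i w) : {ptws nat -> R}))
       /\
       wconv mu (fun _ => setT)
         (fun l x => ((scaled_Phi T (A l) (fine (mu (A l))) x : {ptws nat -> R}),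
                      (Psi_seq T (A l) (loc_obs m (Apart l)) x : {ptws nat -> R})))
         P (fun w => ((fun i => E i w) : {ptws nat -> R},
                      (fun i => Psi i w) : {ptws nat -> R}))).
Proof.
move=> GM ergT mA Apos A0 xiA.
have Apos' l : 0 < pr mu (A l) by rewrite -lte_fin -prE.
split; first by move=> dO O P E; exact: (Poisson_asymptotics _ _ _ _ GM).
move=> m Apart theta _ mAp xiAp AE disj Alim _ dO O P E Psi.
exact: (Poisson_asymptotics_local _ _ _ _ GM ergT A mA Apos' A0 xiA m Apart theta).
Qed.
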